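(* Let $$\alpha:=\prod_{p\ \mathrm{prime}}\left(1-\frac{2}{p^{2}}\right)\quad\text{and}\quad \beta:=\prod_{p\ \mathrm{prime}}\left(1-\frac{3p-2}{p^{3}}\right).$$ For every real $\varepsilon>0$ there exists $n_\varepsilon\in\mathbb{N}$ such that, for every $n\in\mathbb{N}$ with $n\geq n_\varepsilon$, we have $$\frac{\kappa(\mathrm{Sym}(n))}{n}\geq \begin{cases}\dfrac{\alpha}{12}-\varepsilon & \text{if } n \text{ is even},\\[2mm] \dfrac{\beta}{120}-\varepsilon & \text{if } n\text{ is odd},\end{cases}$$ $$\frac{\kappa(\mathrm{Alt}(n))}{n}\geq \begin{cases}\dfrac{\beta}{150}-\varepsilon & \text{if } n \text{ is even},\\[2mm] \dfrac{\alpha}{18}-\varepsilon & \text{if } n\text{ is odd}.\end{cases}$$ Moreover, $\alpha>0.32263$ and $\beta>0.28665$.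
   Context: $\mathrm{Sym}(n)$ and $\mathrm{Alt}(n)$ denote the symmetric and alternating groups on $\{1,\dots,n\}$. For a finite group $G$, $\kappa(G)$ is the maximum size of a set $X$ of conjugacy classes of $G$ such that any pair of elements from distinct classes in $X$ generates $G$ (that is, for all distinct $C,D\in X$ and all $g\in C$, $h\in D$, one has $\langle g,h\rangle=G$). *)

(* Defs.v *)
From mathcomp Require Import all_boot all_order all_algebra all_fingroup.
From mathcomp Require Import all_solvable.
From mathcomp Require Import all_classical all_reals all_analysis.

Set Implicit Arguments.
Unset Strict Implicit.
Unset Printing Implicit Defensive.

Import Order.TTheory GRing.Theory Num.Theory.
Import numFieldNormedType.Exports.

Local Open Scope classical_set_scope.
Local Open Scope ring_scope.

(* The quantifiers are the boolean ones of fintype, so that [kappa] can take a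
   maximum over all sets of classes.  No condition relates two elements of the
   same class: for G != 1 a class C need not contain a generating pair. *)
Definition pairwise_generating (gT : finGroupType) (G : {group gT})
    (X : {set {set gT}}) : bool :=
  (X \subset classes G) &&
  [forall C in X, forall D in X, (C != D) ==>
    [forall g in C, forall h in D, <<[set g; h]%SET>>%g == G :> {set gT}]].

Definition kappa (gT : finGroupType) (G : {group gT}) : nat :=
  (\max_(X : {set {set gT}} | pairwise_generating G X) #|X|)%N.

(* The infinite product over primes, as the limit of the products over the
   primes p < N.  [limn] is total; for [alpha] and [beta] all the factors lie
   in ]0, 1[, so that the partial products decrease and the limit exists. *)
Definition prod_primes (R : realType) (f : nat -> R) : R :=
  limn (fun N : nat => \prod_(0 <= p < N | prime p) f p : R).

Definition alpha (R : realType) : R :=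
  prod_primes (fun p => 1 - 2 / p%:R ^+ 2).

Definition beta (R : realType) : R :=
  prod_primes (fun p => 1 - (3 * p%:R - 2) / p%:R ^+ 3).

(* Main.v *)
(* If a cycle of a permutation [g] has length prime to all the other cycle
   lengths of [g], then it is a power of [g], so that its support is a Jordan
   set of every group [G] containing [g]: the pointwise stabilizer in [G] of the
   complement is transitive on it.  A block of imprimitivity that meets a Jordan
   set contains it or is contained in it.  If [g] has two such cycles, of coprime
   lengths [a] and [b], then all blocks of [G] are trivial as soon as no union of
   cycles of [g] strictly containing one of the two has size a proper divisor of
   [n].  Unions of overlapping Jordan sets are Jordan sets; in a primitive group
   this turns a Jordan set of size [a <= n / 3] into homogeneity on [a]-sets
   (Jordan, Marggraf), so that two of its translates meet in a single point, and
   a commutator supported on their union is a 3-cycle.  Hence a transitive group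
   containing [g] contains Alt(n).

   Two permutations whose cycle lengths have no proper subset sum in common
   generate a transitive group.  The cycle types used are [(a, b, n - a - b)] and
   [(a, b, a + b, n - 2a - 2b)], depending on the required parity, where [a] and
   [b] are odd and grow together: [a = 2(u + t) + 1] and [b = 2(v + s + t) + 1].
   The coprimality conditions fail at an odd prime [p] for a proportion of at
   most [3 / p^2] of the pairs [(s, t)], and [3 * (1/9 + 1/25 + 1/49 + ...)] is
   less than [0.64]; the best shift [s] therefore keeps more than a third of the
   values of [t], which is enough because [alpha <= 0.338] and [beta <= 0.38]. *)
From Stdlib Require Import NArith.
Require Import Defs.
From mathcomp Require Import all_boot all_order all_algebra all_fingroup.
From mathcomp Require Import all_solvable.
From mathcomp Require Import all_classical all_reals all_analysis.
From mathcomp Require Import fintype finset zify ring lra.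

Set Implicit Arguments.
Unset Strict Implicit.
Unset Printing Implicit Defensive.

Import Order.TTheory GRing.Theory Num.Theory.
Import numFieldNormedType.Exports.

Local Open Scope ring_scope.

(** * Jordan sets and Marggraf's theorem *)

Section PermutationGroups.
Local Open Scope nat_scope.
Local Open Scope group_scope.

Section JordanSets.
Variables (T : finType) (G : {group {perm T}}).
Implicit Types (S X Y A B D : {set T}) (g h : {perm T}).

(** Boolean, so that a Jordan set of maximal size can be selected. *)
Definition jordan_set S :=
  [forall x in S, forall y in S, [exists g in G, perm_on S g && (g x == y)]].

Lemma jordan_setP S :
  reflect {in S &, forall x y, exists g, [/\ g \in G, perm_on S g & g x = y]}
          (jordan_set S).
Proof.
apply: (iffP forall_inP) => [H x y xS yS|H x xS].
  have /forall_inP/(_ y yS)/exists_inP[g gG /andP[gS /eqP gxy]] := H x xS.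
  by exists g.
apply/forall_inP=> y yS; have [g [gG gS gxy]] := H x y xS yS.
by apply/exists_inP; exists g; rewrite // gS gxy eqxx.
Qed.

Lemma perm_onS (S S' : {set T}) g : S \subset S' -> perm_on S g -> perm_on S' g.
Proof. by move=> SS' gS; apply: subset_trans SS'. Qed.

(** Elements supported on one of the two sets carry every point of the union to a fixed common point
    [w]; composing two of them joins any two points. *)
Lemma jordan_setU S S' : jordan_set S -> jordan_set S' ->
  S :&: S' != set0 -> jordan_set (S :|: S').
Proof.
move=> /jordan_setP JS /jordan_setP JS' /set0Pn[w /setIP[wS wS']].
have toW x : x \in S :|: S' ->
    exists g, [/\ g \in G, perm_on (S :|: S') g & g x = w].
  case/setUP=> [xS|xS'].
    have [g [gG gS gx]] := JS x w xS wS; exists g; split=> //.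
    exact: perm_onS (subsetUl _ _) gS.
  have [g [gG gS gx]] := JS' x w xS' wS'; exists g; split=> //.
  exact: perm_onS (subsetUr _ _) gS.
apply/jordan_setP => x y /toW[g [gG gS gx]] /toW[h [hG hS hy]].
exists (g * h^-1); split; first by rewrite groupM ?groupV.
  by rewrite perm_onM ?perm_onV.
by rewrite permM gx -hy permK.
Qed.

Lemma perm_on_imset S g (x : {perm T}) : perm_on S x -> perm_on (g @: S) (x ^ g).
Proof.
move=> xS; apply/subsetP=> z; rewrite inE -{1 2}(permKV g z) permJ => neq.
rewrite -(permKV g z) imset_f //; move/subsetP: xS; apply.
by rewrite inE; apply: contraNneq neq => ->.
Qed.

Lemma jordan_set_imset S g : g \in G -> jordan_set S -> jordan_set (g @: S).
Proof.
move=> gG /jordan_setP JS; apply/jordan_setP=> _ _ /imsetP[x xS ->] /imsetP[y yS ->].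
have [h [hG hS hxy]] := JS x y xS yS; exists (h ^ g); split.
- by rewrite groupJ.
- exact: perm_on_imset.
by rewrite permJ hxy.
Qed.

Definition stable_block X := {in G, forall g, g @: X :&: X != set0 -> g @: X = X}.

Definition transitive_perm := {in setT &, forall x y, exists2 g, g \in G & g x = y}.

Definition primitive_perm :=
  transitive_perm /\ forall X, stable_block X -> 1 < #|X| -> X = setT.

Lemma imsetM g h X : (g * h) @: X = h @: (g @: X).
Proof. by rewrite -imset_comp; apply: eq_imset => x; rewrite /= permM. Qed.

Lemma imset_permK g X : (g^-1)%g @: (g @: X) = X.
Proof. by rewrite -imsetM mulgV imset_perm1. Qed.

Lemma imset_permKV g X : g @: ((g^-1)%g @: X) = X.
Proof. by rewrite -imsetM mulVg imset_perm1. Qed.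

Lemma card_imset_perm g X : #|g @: X| = #|X|.
Proof. by rewrite card_imset //; apply: perm_inj. Qed.

Lemma mem_imset_perm g X x : (g x \in g @: X) = (x \in X).
Proof. by rewrite mem_imset //; apply: perm_inj. Qed.

Lemma stable_block_imset X g : g \in G -> stable_block X -> stable_block (g @: X).
Proof.
move=> gG bX h hG /set0Pn[z /setIP[]]; rewrite -imsetM => /imsetP[x xX zE] zgX.
have := bX (g * h * g^-1); rewrite !groupM ?groupV // => /(_ isT) E.
rewrite -{2}E; first by rewrite [in RHS]imsetM imset_permKV.
apply/set0Pn; exists (g^-1 z); rewrite inE imsetM {1}zE !mem_imset_perm.
by rewrite xX; move/imsetP: zgX => [t tX ->]; rewrite permK.
Qed.

(** If [X] has a point outside [S], elements supported on [S] fix that point and hence preserve [X];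
    yet they carry a point of [X :&: S] to every point of [S]. *)
Lemma block_jordan_set X S : stable_block X -> jordan_set S ->
  X :&: S != set0 -> (S \subset X) || (X \subset S).
Proof.
move=> bX /jordan_setP JS /set0Pn[y /setIP[yX yS]].
have [//|/subsetPn[x xX xS]] := boolP (X \subset S); first by rewrite orbT.
rewrite orbF; apply/subsetP=> z zS; have [u [uG uS <-]] := JS y z yS zS.
rewrite -(bX u uG) ?mem_imset_perm //; apply/set0Pn; exists x.
by rewrite inE xX -{1}(out_perm uS xS) mem_imset_perm xX.
Qed.

End JordanSets.

(** * Homogeneity and Jordan sets in primitive groups *)

Section Homogeneity.
Variables (T : finType) (G : {group {perm T}}).
Implicit Types (S X Y A B D : {set T}) (g h : {perm T}).
Local Notation jordan_set := (jordan_set G).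

(** Exchange argument: for [x] in [S :\: S'] and [y] in [S' :\: S], an element supported on the
    Jordan set [y |: S] and moving [y] to [x] replaces [x] by [y] in [S]. *)
Lemma jordan_homogeneous m S S' :
  (forall S, #|S| = m.+1 -> jordan_set S) -> #|S| = m -> #|S'| = m ->
  exists2 g, g \in G & g @: S = S'.
Proof.
move=> J; have [k] := ubnP #|S :\: S'|; elim: k S => // k IH S lek cS cS'.
have [sSS'|/subsetPn[x xS xS']] := boolP (S \subset S').
  exists 1; first exact: group1.
  by rewrite imset_perm1; apply/eqP; rewrite eqEcard sSS' cS cS' leqnn.
have /subsetPn[y yS' yS]: ~~ (S' \subset S).
  apply: contra xS' => sS'S; suff -> : S' = S by [].
  by apply/eqP; rewrite eqEcard sS'S cS cS' leqnn.
have /jordan_setP JS : jordan_set (y |: S) by apply: J; rewrite cardsU1 yS cS.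
have [g [gG gS gyx]] := JS y x (setU11 _ _) (setU1r _ xS).
have gE z : z \in g @: S -> (z != x) && ((z == y) || (z \in S)).
  case/imsetP=> t tS ->; have := perm_closed t gS; rewrite !inE tS orbT => ->.
  by rewrite andbT -gyx (inj_eq perm_inj); apply: contraNneq yS => <-.
have [||//|h hG hE] := IH (g @: S).
- apply: leq_trans (ltnSE lek); apply: proper_card; apply/properP; split.
    apply/subsetP=> z; rewrite !inE => /andP[zS' /gE/andP[_ /orP[/eqP zy|->]]].
      by rewrite zy yS' in zS'.
    by rewrite zS'.
  exists x; rewrite !inE ?xS ?xS' //=; apply/negP => /gE.
  by rewrite eqxx.
- by rewrite card_imset_perm.
by exists (g * h); rewrite ?groupM // imsetM.
Qed.

(* Rudio's lemma *)
Lemma primitive_separating S x y : primitive_perm G -> S != set0 -> S != setT ->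
  x != y -> exists g, [/\ g \in G, x \in g @: S & y \notin g @: S].
Proof.
move=> [trG primG] S0 ST xy.
(* [cl z] is the intersection of the translates of [S] through [z]. By transitivity these sets have
   equal sizes, so an inclusion between two of them is an equality and they are blocks. *)
pose cl z := [set t | [forall g in G, (z \in g @: S) ==> (t \in g @: S)]].
have clP z t : reflect (forall g, g \in G -> z \in g @: S -> t \in g @: S)
                       (t \in cl z).
  rewrite inE; apply: (iffP forall_inP) => H g gG; first exact/implyP/H.
  exact/implyP/H.
have clJ g z : g \in G -> g @: cl z = cl (g z).
  move=> gG; apply/setP=> t; rewrite -{1}(permKV g t) mem_imset_perm.
  apply/clP/clP => H h hG.
    have := H (h * g^-1); rewrite groupM ?groupV // imsetM => /(_ isT).
    rewrite -(mem_imset_perm g _ z) imset_permKV => Hz /Hz.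
    by rewrite -(mem_imset_perm g _ (g^-1 t)) imset_permKV permKV.
  have := H (h * g); rewrite groupM // imsetM mem_imset_perm => /(_ isT).
  by rewrite -{1}(permKV g t) mem_imset_perm.
have cl_id z : z \in cl z by apply/clP.
have cl_eq z t : t \in cl z -> cl t = cl z.
  move=> tz; apply/eqP; rewrite eqEcard; apply/andP; split.
    apply/subsetP=> w /clP tw; apply/clP=> g gG zS; apply: tw => //.
    exact: (clP z t tz).
  by have [g gG <-] := trG z t (in_setT _) (in_setT _); rewrite -clJ // card_imset_perm.
have blk : stable_block G (cl x).
  move=> g gG; rewrite clJ // => /set0Pn[z /setIP[z1 z2]].
  by rewrite -(cl_eq _ _ z1) -(cl_eq _ _ z2).
suff /negP : ~ y \in cl x.
  rewrite inE negb_forall => /existsP[g]; rewrite !negb_imply => /and3P[*].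
  by exists g.
move=> yx; have clT : cl x = setT.
  by apply: primG => //; apply/card_gt1P; exists x, y.
have /set0Pn[s sS] := S0; case/negP: ST; apply/eqP/setP=> t; rewrite inE.
have [g gG gx] := trG s x (in_setT _) (in_setT _).
have : g t \in cl x by rewrite clT.
by move/clP/(_ g gG); rewrite -gx !mem_imset_perm => /(_ sS).
Qed.

(** Such a group is 2-transitive: a maximal proper Jordan set [D] turns out to miss a single point,
    and transitivity moves it to every point complement. *)
Lemma jordan_set_cover1 S : primitive_perm G -> jordan_set S ->
  1 < #|S| < #|T| -> forall S', #|S'| = #|T|.-1 -> jordan_set S'.
Proof.
move=> primG JS cS.
have [D /andP[JD /andP[D1 DT]] maxD] := @arg_maxnP _ S
  (fun D => jordan_set D && (1 < #|D| < #|T|)) (fun D => #|D|)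
  (introT andP (conj JS cS)).
have D0 : D != set0 by rewrite -card_gt0; lia.
have DnT : D != setT by apply: contraTneq DT => ->; rewrite cardsT ltnn.
have maxDg g : g \in G -> D :&: g @: D != set0 ->
    ~~ (g @: D \subset D) -> D :|: g @: D = setT.
  move=> gG meet nsub; apply/eqP; rewrite eqEcard subsetT cardsT leqNgt.
  apply/negP=> lt; have := maxD (D :|: g @: D).
  rewrite jordan_setU ?jordan_set_imset // lt andbT /=.
  have sub : #|D| < #|D :|: g @: D|.
    apply: proper_card; rewrite properE subsetUl subUset subxx /=.
    exact: nsub.
  by move=> /(_ (ltn_trans D1 sub)); rewrite leqNgt sub.
have cD : #|D| = #|T|.-1.
  apply/eqP; rewrite eqn_leq; apply/andP; split; first by lia.
  rewrite leqNgt; apply/negP => ltD.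
  (* A translate separating two points contradicts [maxDg]: for a small [D] both points are taken
     inside, and the union is too small to be everything; for a large [D] both are taken outside,
     the translate must meet [D], and the union misses [y]. *)
  have [leD|gtD] := leqP (2 * #|D|) #|T|.
    have [x [y [xD yD xy]]] := card_gt1P D1.
    have [g [gG xg yg]] := primitive_separating primG D0 DnT xy.
    have DgT : D :|: g @: D = setT.
      apply: maxDg => //; first by apply/set0Pn; exists x; rewrite inE xD.
      apply: contra yg => sub; suff -> : g @: D = D by [].
      by apply/eqP; rewrite eqEcard sub card_imset_perm leqnn.
    have := cardsUI D (g @: D); rewrite DgT cardsT card_imset_perm.
    have : 0 < #|D :&: g @: D|.
      by rewrite card_gt0; apply/set0Pn; exists x; rewrite inE xD.
    by move: leD; clear; lia.
  have /card_gt1P[x [y [xD yD xy]]] : 1 < #|~: D|.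
    by have := cardsC D; lia.
  have [g [gG xg yg]] := primitive_separating primG D0 DnT xy.
  have /setP/(_ y) : D :|: g @: D = setT.
    apply: maxDg => //.
      rewrite -card_gt0; have := cardsUI D (g @: D); rewrite card_imset_perm.
      by have := max_card (D :|: g @: D); move: gtD; clear; lia.
    by apply/subsetPn; exists x; rewrite // -in_setC.
  by rewrite !inE (negPf yg) orbF; move: yD; rewrite inE => /negPf->.
move=> S' cS'.
have c1 X : #|X| = #|T|.-1 -> exists z, X = [set~ z].
  move=> cX; have /cards1P[z zE] : #|~: X| == 1%N by have := cardsC X; lia.
  by exists z; rewrite -zE setCK.
have [[a aE] [b bE]] := (c1 _ cD, c1 _ cS'); rewrite bE.
have [g gG gab] := primG.1 a b (in_setT _) (in_setT _).
suff -> : [set~ b] = g @: D by apply: jordan_set_imset.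
apply/setP=> z; rewrite -{2}(permKV g z) mem_imset_perm aE !inE -gab.
by rewrite -{1}(permKV g z) (inj_eq perm_inj).
Qed.

End Homogeneity.

Lemma subset_of_card (T : finType) (A : {set T}) k : k <= #|A| ->
  exists2 B : {set T}, B \subset A & #|B| = k.
Proof.
move=> lekA; exists [set x in take k (enum A)].
  by apply/subsetP=> x; rewrite inE => /mem_take; rewrite mem_enum.
rewrite cardsE (card_uniqP _) ?take_uniq ?enum_uniq //.
by rewrite size_takel // -cardE.
Qed.

Section Growth.
Variables (T : finType) (G : {group {perm T}}).
Implicit Types (S X Y A B D : {set T}) (g h : {perm T}).
Local Notation jordan_set := (jordan_set G).

Lemma imset_permC g S : g @: (~: S) = ~: (g @: S).
Proof.
by apply/setP=> z; rewrite -(permKV g z) inE !mem_imset_perm inE.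
Qed.

Lemma jordan_homogeneousC m S S' :
  (forall S, #|S| = m.+1 -> jordan_set S) -> #|S| + m = #|T| -> #|S'| = #|S| ->
  exists2 g, g \in G & g @: S = S'.
Proof.
move=> J cS cS'.
have [||g gG] := jordan_homogeneous (S := ~: S) (S' := ~: S') J.
- by have := cardsC S; lia.
- by have := cardsC S'; lia.
by rewrite imset_permC => /setC_inj; exists g.
Qed.

(* Let [D] be a Jordan set of maximal size at most [m].  If it had size less than
   [m], the complements of its translates would behave like the blocks of a
   Steiner system: those through a point [c] of [C], a fixed set [W] of
   [#|T| - m - 2] points outside [C] and one more point outside [C] would meet
   [C] in pairwise distinct further points, but [C] is too small for that. *)
Lemma jordan_set_step m C : primitive_perm G ->
  (forall S, #|S| = m.+1 -> jordan_set S) -> jordan_set C ->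
  2 < #|C| -> 2 * #|C| <= m.+2 -> m.+2 <= #|T| ->
  forall S, #|S| = m -> jordan_set S.
Proof.
move=> primG J JC C3 leC lem.

have J1 : forall S, #|S| = (#|T|.-2).+1 -> jordan_set S.
  by move=> S cS; apply: jordan_set_cover1 primG JC _ _ _; lia.
have leCm : #|C| <= m by lia.
have [D /andP[JD leD] maxD] := @arg_maxnP _ C
  (fun D => jordan_set D && (#|D| <= m)) (fun D => #|D|)
  (introT andP (conj JC leCm)).
have [cD|neD] := eqVneq #|D| m.
  move=> S cS; have [g gG <-] := jordan_homogeneous J cD cS.
  exact: jordan_set_imset.
have ltD : #|D| < m by lia.
have C0 : #|C| <= #|D| by apply: maxD; rewrite JC.
(* By maximality of [D], a Jordan set properly containing a translate of [D] has more than [m]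
   points. *)
have grow X h : h \in G -> jordan_set X -> X :&: h @: D != set0 ->
    ~~ (X \subset h @: D) -> m < #|X :|: h @: D|.
  move=> hG JX meet nsub; rewrite ltnNge; apply/negP=> leU.
  have := maxD (X :|: h @: D).
  rewrite jordan_setU ?jordan_set_imset // leU => /(_ isT).
  apply/negP; rewrite -ltnNge -(card_imset_perm h D); apply: proper_card.
  by rewrite properE subsetUr subUset subxx andbT.
(* By 2-homogeneity some translate of [C] contains a point of [D] and a point outside it; [grow]
   bounds the size of its union with [D] from below. *)
have bigD : m + 2 <= #|D| + #|C|.
  have /card_gt0P[x xD] : 0 < #|D| by lia.
  have /card_gt0P[y yD] : 0 < #|~: D| by have := cardsC D; lia.
  have /card_gt1P[p [q [pC qC pq]]] : 1 < #|C| by lia.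
  have xy : x != y by apply: contraTneq yD => <-; rewrite inE xD.
  have [||g gG gE] := jordan_homogeneousC (S := [set p; q]) (S' := [set x; y]) J1.
  - by rewrite cards2 pq; move: C3 leCm lem; set n := #|T|; clearbody n; clear; lia.
  - by rewrite !cards2 pq xy.
  have sub : [set x; y] \subset g @: C.
    by rewrite -gE imsetS // subUset !sub1set pC.
  have xC : x \in g @: C by rewrite (subsetP sub) // set21.
  have yC : y \in g @: C by rewrite (subsetP sub) // set22.
  have := grow (g @: C) 1 (group1 _); rewrite imset_perm1.
  have I0 : g @: C :&: D != set0 by apply/set0Pn; exists x; rewrite inE xC xD.
  rewrite jordan_set_imset // I0 => /(_ isT isT) grow1.
  have {grow1} : m < #|g @: C :|: D| by apply/grow1/subsetPn; exists y; rewrite // -in_setC.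
  have := cardsUI (g @: C) D; move: I0; rewrite -card_gt0 card_imset_perm.
  by clear; lia.
have /card_gt0P[c cC] : 0 < #|C| by lia.
have [|W sWC cW] := @subset_of_card _ (~: C) (#|T| - m - 2).
  by have := cardsC C; lia.
(* In terms of the complements of translates of [D]: the one given by [h] contains [c], [d] and [W].
   [P d c'] says that some such complement also contains [c']. *)
pose miss d h := [disjoint (c |: (d |: W)) & h @: D].
pose P d c' := [exists h in G, miss d h && (c' \notin h @: D)].
have WC w : w \in W -> w \notin C by move/(subsetP sWC); rewrite inE.
have cW1 : c \notin W by apply: contraL cC => /WC.
(* Homogeneity provides the translate, since [c |: (d |: W)] has [#|T| - m] points. If it contained
   [C :\ c], its union with [C] would have only [#|D| + 1 <= m] points, against [grow]. *)
have exP d : d \in ~: C :\: W -> exists2 c', c' \in C :\ c & P d c'.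
  rewrite !inE => /andP[dW dC].
  have [|K sKD cK] := @subset_of_card _ (~: D) (#|T| - m).
    by have := cardsC D; move: leD lem; set n := #|T|; clearbody n; clear; lia.
  have cWd : #|c |: (d |: W)| = #|K|.
    rewrite !cardsU1 cW cK dW !inE negb_or cW1 andbT.
    have -> : c != d by apply: contraNneq dC => <-.
    by move: C3 leCm lem; set n := #|T|; clearbody n; clear; lia.
  have [||h hG hE] := jordan_homogeneousC (S := K) (S' := c |: (d |: W)) J.
  - by rewrite cK; move: lem; set n := #|T|; clearbody n; clear; lia.
  - exact: cWd.
  have mh : miss d h.
    by rewrite /miss -hE disjoints_subset -imset_permC imsetS.
  have [/subsetP sub|/subsetPn[c' c'C c'D]] := boolP (C :\ c \subset h @: D); last first.
    by exists c' => //; apply/exists_inP; exists h; rewrite // mh.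
  have cD : c \notin h @: D by have := disjointFr mh (setU11 _ _) => ->.
  have /card_gt0P[z zC] : 0 < #|C :\ c|.
    by have := cardsD1 c C; rewrite cC; move: C3; clear; lia.
  have : m < #|C :|: h @: D|.
    apply: grow => //; last by apply/subsetPn; exists c.
    by apply/set0Pn; exists z; rewrite inE sub // andbT; case/setD1P: zC.
  suff -> : C :|: h @: D = c |: h @: D.
    by rewrite cardsU1 cD card_imset_perm; move: ltD; clear; lia.
  apply/setP=> w; rewrite !in_setU in_set1; case: eqVneq => [->|wc]; first by rewrite cC.
  by case wC : (w \in C) => //=; rewrite sub // !inE wc.
(* Both translates miss the [#|T| - m] points of [[set c; c'] :|: W], so their union is small and
   they coincide. If [d != d'], this common translate and [C] both miss [[set d; d'] :|: W], and
   their union is again too small. *)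
have uniqP d d' c' : d \in ~: C :\: W -> d' \in ~: C :\: W -> c' \in C :\ c ->
    P d c' -> P d' c' -> d = d'.
  rewrite !inE => /andP[dW dC] /andP[dW' dC'] /andP[c'c c'C].
  move=> /exists_inP[h hG /andP[mh ch]] /exists_inP[h' hG' /andP[mh' ch']].
  apply/eqP; apply/negPn/negP=> dd'.
  have missU (U X : {set T}) k : #|U| = k -> [disjoint U & X] -> #|X| + k <= #|T|.
    move=> <-; rewrite -setI_eq0 => /eqP UX; have := cardsUI U X.
    by rewrite UX cards0 addn0 => E; rewrite addnC -E max_card.
  have c'W : c' \notin W by apply: contraL c'C => /WC.
  have disj X d0 h0 : miss d0 h0 -> c' \notin h0 @: D -> X \subset [set c; c'; d0] :|: W ->
      [disjoint X & h0 @: D].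
    move=> m0 c0 sub; rewrite disjoint_sym disjoints_subset; apply/subsetP=> z zD.
    rewrite inE; apply/negP=> /(subsetP sub); rewrite !inE -!orbA.
    case/or4P=> [/eqP E|/eqP E|/eqP E|zW].
    - by have := disjointFl m0 zD; rewrite E setU11.
    - by rewrite -E zD in c0.
    - by have := disjointFl m0 zD; rewrite E !inE eqxx orbT.
    by have := disjointFl m0 zD; rewrite !inE zW !orbT.
  have cK1 : #|[set c; c'] :|: W| = #|T| - m.
    rewrite -setUA !cardsU1 cW !inE negb_or cW1 c'W eq_sym c'c /=.
    by move: C3 leCm lem; set n := #|T|; clearbody n; clear; lia.
  have leU : #|h @: D :|: h' @: D| <= m.
    suff /(missU _ _ _ cK1) : [disjoint [set c; c'] :|: W & h @: D :|: h' @: D].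
      by move: lem; set n := #|T|; clearbody n; clear; lia.
    rewrite -setI_eq0 setIUr setU_eq0 !setI_eq0.
    by apply/andP; split; [apply: disj mh ch _|apply: disj mh' ch' _];
      apply: setSU; rewrite subsetUl.
  have [I0|I1] := eqVneq (h @: D :&: h' @: D) set0.
    have := cardsUI (h @: D) (h' @: D); rewrite I0 cards0 !card_imset_perm.
    by move: leU bigD leC; clear; lia.
  have hh' : h @: D = h' @: D.
    apply/eqP; rewrite eqEcard !card_imset_perm leqnn andbT.
    apply: contraT => nsub; have := grow _ _ hG' (jordan_set_imset hG JD) I1 nsub.
    by rewrite ltnNge leU.
  rewrite /miss -hh' in mh' ch'.
  have mdd : [disjoint [set d; d'] :|: W & h @: D].
    rewrite disjoint_sym disjoints_subset; apply/subsetP=> z zD; rewrite inE; apply/negP.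
    rewrite !inE -!orbA => /or3P[/eqP E|/eqP E|zW].
    - by have := disjointFl mh zD; rewrite E !inE eqxx orbT.
    - by have := disjointFl mh' zD; rewrite E !inE eqxx orbT.
    by have := disjointFl mh zD; rewrite !inE zW !orbT.
  have cdd : #|[set d; d'] :|: W| = #|T| - m.
    rewrite -setUA !cardsU1 cW !inE negb_or dW dW' dd' /=.
    by move: C3 leCm lem; set n := #|T|; clearbody n; clear; lia.
  have [CD0|CD1] := eqVneq (C :&: h @: D) set0.
    have : [disjoint C :|: ([set d; d'] :|: W) & h @: D].
      by rewrite -setI_eq0 setIUl CD0 set0U setI_eq0.
    have C0' : C :&: ([set d; d'] :|: W) = set0.
      apply/setP=> z; rewrite !inE; apply/negP=> /andP[zC].
      rewrite -orbA => /or3P[/eqP E|/eqP E|/WC/negP//]; by rewrite -E zC in dC dC' *.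
    move=> /(missU _ _ _ erefl); have := cardsUI C ([set d; d'] :|: W).
    rewrite C0' cards0 addn0 => ->; rewrite cdd card_imset_perm.
    by move: lem bigD; set n := #|T|; clearbody n; clear; lia.
  have : m < #|C :|: h @: D|.
    apply: grow => //; apply/subsetPn; exists c => //.
    by have := disjointFr mh (setU11 _ _) => ->.
  suff /(missU _ _ _ cdd) : [disjoint [set d; d'] :|: W & C :|: h @: D].
    by move: lem; set n := #|T|; clearbody n; clear; lia.
  rewrite -setI_eq0 setIUr setU_eq0 !setI_eq0 mdd andbT.
  rewrite disjoints_subset; apply/subsetP=> z; rewrite !inE -orbA.
  by case/or3P=> [/eqP->|/eqP->|/WC].
pose f d := odflt c [pick c' in C :\ c | P d c'].
have fP d : d \in ~: C :\: W -> f d \in C :\ c /\ P d (f d).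
  move=> dC; rewrite /f; case: pickP => [c' /andP[]//|no].
  by have [c' c1 c2] := exP d dC; have := no c'; rewrite c1 c2.
have inj_f : {in ~: C :\: W &, injective f}.
  move=> d d' dC dC' E; apply: (uniqP d d' (f d)) => //.
  - by case: (fP d dC).
  - by case: (fP d dC).
  by rewrite E; case: (fP d' dC').
have := card_in_imset inj_f.
have : f @: (~: C :\: W) \subset C :\ c.
  by apply/subsetP=> _ /imsetP[d dC ->]; case: (fP d dC).
(* The injection [f] goes from [m + 2 - #|C| >= #|C|] points to [#|C| - 1] points. *)
move=> /subset_leq_card; have := cardsD1 c C; rewrite cC.
have := cardsD (~: C) W; rewrite (setIidPr sWC) cW; have := cardsC C.
by move: leC lem C3 leCm; set n := #|T|; clearbody n; clear; lia.
Qed.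

End Growth.

(** * Three-cycles and the alternating group *)

(** Induction on the support: an even [s] moving [x] moves a third point [z], and an element [c] of
    [H] supported on [[set x; s x; z]] sends [s x] back to [x]. Then [s * c] is even and has a
    smaller support. *)
Lemma Alt_sub_of_triples (T : finType) (H : {group {perm T}}) :
  H \subset 'Alt_T -> (forall S : {set T}, #|S| = 3 -> jordan_set H S) ->
  'Alt_T \subset H.
Proof.
move=> HA J; apply/subsetP=> s; rewrite Alt_even.
have [A] : exists A, perm_on A s by exists setT; apply/subsetP=> x; rewrite !inE.
have [k] := ubnP #|A|; elim: k A s => // k IH A s leA sA even_s.
have [->|s1] := eqVneq s 1; first exact: group1.
have [x sx] : exists x, s x != x.
  apply/existsP; apply: contraNT s1; rewrite negb_exists => /forallP fix_s.
  by apply/eqP/permP=> x; rewrite perm1; apply/eqP; rewrite -[_ == _]negbK.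
have xA : x \in A by move/subsetP: sA; apply; rewrite inE.
have sxA : s x \in A by rewrite perm_closed.
have [B0|/set0Pn[z]] := eqVneq (A :\: [set x; s x]) set0.
  have sE : s = tperm x (s x).
    apply/permP=> y; case: tpermP => [->//|->|/eqP yx /eqP ysx].
      apply/eqP; rewrite -[_ == _]negbK; apply: contraT; rewrite negbK => ssx.
      have : s (s x) \in A :\: [set x; s x].
        by rewrite !inE perm_closed // sxA (inj_eq perm_inj) negb_or ssx sx.
      by rewrite B0 inE.
    apply: out_perm sA _; apply/negP=> yA.
    have : y \in A :\: [set x; s x] by rewrite !inE negb_or yx ysx.
    by rewrite B0 inE.
  by move: even_s; rewrite sE odd_tperm eq_sym sx.
rewrite !inE negb_or => /andP[/andP[zx zsx] zA].
pose S := [set x; s x; z].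
have cS : #|S| = 3 by rewrite /S setUC cardsU1 cards2 !inE negb_or zx zsx eq_sym sx.
have SA : S \subset A.
  by apply/subsetP=> y; rewrite !inE -orbA => /or3P[]/eqP->.
have [|| c [cH cS1 cE]] := jordan_setP _ _ (J S cS) (s x) x; rewrite ?inE ?eqxx ?orbT //.
have cA : ~~ c by rewrite -Alt_even (subsetP HA).
suff : s * c \in H by rewrite groupMr.
apply: (IH (A :\ x)).
- by have := cardsD1 x A; rewrite xA; move: leA; clear; lia.
- have scA : perm_on A (s * c) by apply: perm_onM => //; apply: perm_onS SA cS1.
  apply/subsetP=> y yN; rewrite !inE (subsetP scA) // andbT.
  by apply: contraTneq yN => ->; rewrite inE permM cE eqxx.
by rewrite odd_permM (negPf even_s) (negPf cA).
Qed.

(** Parity excludes a transposition, so [z] is a 3-cycle and its powers are transitive on [S]. *)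
Lemma jordan_set_even3 (T : finType) (H : {group {perm T}}) (S : {set T}) z :
  #|S| = 3 -> z \in H -> perm_on S z -> ~~ odd_perm z -> z != 1 -> jordan_set H S.
Proof.
move=> cS zH zS even_z z1.
have [x zx] : exists x, z x != x.
  apply/existsP; apply: contraNT z1; rewrite negb_exists => /forallP fix_s.
  by apply/eqP/permP=> x; rewrite perm1; apply/eqP; rewrite -[_ == _]negbK.
have xS : x \in S by move/subsetP: zS; apply; rewrite inE.
have zxS : z x \in S by rewrite perm_closed.
have zzx : z (z x) != x.
  apply: contraNneq even_z => E; suff -> : z = tperm x (z x) by rewrite odd_tperm eq_sym.
  have /eqP/cards1P[w wE] : #|S :\ x :\ z x| = 1%N.
    have := cardsD1 x S; have := cardsD1 (z x) (S :\ x).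
    by rewrite !inE xS zx zxS cS /=; clear; lia.
  have SE y : y \in S -> [\/ y = x, y = z x | y = w].
    move=> yS; case: (eqVneq y x) => [|yx]; first by constructor 1.
    case: (eqVneq y (z x)) => [|yzx]; first by constructor 2.
    by constructor 3; apply/eqP; rewrite -in_set1 -wE !inE yx yzx.
  have := set11 w; rewrite -wE !inE => /and3P[wzx wx wS].
  apply/permP=> y; case: tpermP => [->//|->//|/eqP yx /eqP yzx].
  have [yS|yS] := boolP (y \in S); last exact: out_perm yS.
  have [/eqP|/eqP|->] := SE y yS; rewrite ?(negPf yx) ?(negPf yzx) //.
  have : z w \in S by rewrite perm_closed.
  case/SE => [|/perm_inj E1|//]; last by rewrite E1 eqxx in wx.
  by rewrite -[in RHS]E => /perm_inj E1; rewrite E1 eqxx in wzx.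
have SE : S = [set x; z x; z (z x)].
  apply/esym/eqP; rewrite eqEcard cS; apply/andP; split.
    by apply/subsetP=> y; rewrite !inE -orbA => /or3P[]/eqP->; rewrite ?perm_closed.
  rewrite setUC cardsU1 cards2 !inE negb_or zzx (inj_eq perm_inj) zx.
  by rewrite eq_sym zx.
have zzz : z (z (z x)) = x.
  have : z (z (z x)) \in S by rewrite !perm_closed.
  rewrite SE !inE !(inj_eq perm_inj) (negPf zzx) (negPf zx) !orbF.
  by move/eqP.
have toX y : y \in S -> exists g, [/\ g \in H, perm_on S g & g y = x].
  rewrite SE !inE -orbA -SE => /or3P[]/eqP->.
  - by exists 1; rewrite group1 perm_on1 perm1.
  - by exists (z * z); rewrite groupM // perm_onM // !permM.
  by exists z.
apply/jordan_setP=> p q /toX[g [gH gS gp]] /toX[h [hH hS hq]].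
by exists (g * h^-1); rewrite groupM ?groupV // perm_onM ?perm_onV // permM gp -hq permK.
Qed.

(* A weak form of Marggraf's theorem *)
Theorem Alt_sub_of_jordan_set (T : finType) (G : {group {perm T}}) (C : {set T}) :
  primitive_perm G -> jordan_set G C -> 2 < #|C| -> 3 * #|C| <= #|T| ->
  'Alt_T \subset G.
Proof.
move=> primG JC C3 leC.
(* Starting from the point complements, [jordan_set_step] can be iterated down to size
   [2 * #|C| - 2]. *)
have down j (S : {set T}) : 2 * #|C| + j <= #|T|.+1 -> #|S| = #|T|.-1 - j -> jordan_set G S.
  elim: j S => [|j IH] S lej cS.
    apply: jordan_set_cover1 primG JC _ _ _; last by rewrite cS subn0.
    by move: C3 leC; set n := #|T|; clearbody n; clear; lia.
  apply: (@jordan_set_step _ _ (#|T|.-1 - j.+1) C) => //.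
  - move=> S' cS'; apply: IH; first by move: lej; clear; lia.
    by move: lej C3 cS'; set n := #|T|; clearbody n; clear; lia.
  - by move: lej C3; set n := #|T|; clearbody n; clear; lia.
  - by move: lej C3; set n := #|T|; clearbody n; clear; lia.
have homog (S S' : {set T}) : 1 < #|S| <= #|C| -> #|S'| = #|S| ->
    exists2 g, g \in G & g @: S = S'.
  move=> leS; apply: (@jordan_homogeneousC _ _ (#|T| - #|S|)).
    move=> X cX; apply: (down (#|S| - 2)).
      by move: leS leC; set n := #|T|; clearbody n; clear; lia.
    by move: cX leS leC; set n := #|T|; clearbody n; clear; lia.
  by have := max_card S; clear; lia.
have /card_gt0P[w wC] : 0 < #|C| by lia.
(* By homogeneity [w |: B] is a translate of [C], and it meets [C] in [w] alone. *)
have [|B sBC cB] := @subset_of_card _ (~: C) (#|C|.-1).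
  by have := cardsC C; move: leC; set n := #|T|; clearbody n; clear; lia.
have wB : w \notin B by apply: contraL wC => /(subsetP sBC); rewrite inE.
have [||g gG gE] := homog C (w |: B).
- by rewrite leqnn andbT; apply: leq_trans C3.
- by rewrite cardsU1 wB cB; move: C3; clear; lia.
have CC' y : y \in C -> y \in g @: C -> y = w.
  move=> yC; rewrite gE !inE => /orP[/eqP//|/(subsetP sBC)]; by rewrite inE yC.
have moves (D : {set T}) : jordan_set G D -> w \in D -> 1 < #|D| ->
    exists x, [/\ x \in G, perm_on D x & x w != w].
  move=> /jordan_setP JD wD D1.
  have /card_gt0P[u] : 0 < #|D :\ w| by have := cardsD1 w D; rewrite wD; move: D1; clear; lia.
  rewrite !inE => /andP[uw uD]; have [x [xG xD xw]] := JD w u wD uD.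
  by exists x; rewrite xw.
have [x [xG xC xw]] := moves C JC wC (ltnW C3).
have [||y [yG yC yw]] := moves (g @: C) (jordan_set_imset gG JC).
- by rewrite gE setU11.
- by rewrite card_imset_perm; apply: ltnW.
have ywC : y w \notin C.
  by apply: contra yw => h; rewrite (CC' _ h) // perm_closed // gE setU11.
have xwC : x w \notin g @: C.
  by apply: contra xw => h; rewrite (CC' (x w)) // perm_closed.
(* The supports of [x] and [y] share only [w], so the commutator moves at most [w], [x w] and
   [y w]. *)
pose z := [~ x, y].
have zE t : z t = y (x (y^-1 (x^-1 t))) by rewrite /z commgEl conjgE !permM.
have VonC t : (x^-1 t \in C) = (t \in C) by rewrite perm_closed // perm_onV.
have VonC' t : (y^-1 t \in g @: C) = (t \in g @: C) by rewrite perm_closed // perm_onV.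
have VC t : t \notin C -> x^-1 t = t by apply: out_perm; rewrite perm_onV.
have VC' t : t \notin g @: C -> y^-1 t = t by apply: out_perm; rewrite perm_onV.
have zw : z w = y w.
  rewrite zE VC' ?permKV //; apply: contra xw => h.
  by rewrite -[X in x X == _](CC' _ _ h) ?VonC // permKV.
have zS : perm_on [set w; x w; y w] z.
  apply/subsetP=> t; rewrite [t \in [pred _ | _]]inE; apply: contraR; rewrite !inE !negb_or.
  move=> /andP[/andP[tw txw] tyw]; apply/eqP; rewrite zE.
  have [tC|tC] := boolP (t \in C).
    rewrite VC' ?permKV.
      by apply: out_perm yC _; apply: contra tw => /(CC' _ tC)->.
    apply: contra txw => h; apply/eqP.
    by rewrite -[w](CC' (x^-1 t)) ?VonC // permKV.
  rewrite (VC t tC) [x _](out_perm xC) ?permKV //.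
  have [tC'|tC'] := boolP (t \in g @: C); last by rewrite VC'.
  apply: contra tyw => h; apply/eqP.
  by rewrite -[w](CC' (y^-1 t)) ?VonC' // permKV.
have z1 : z != 1 by apply: contraNneq yw => z1; rewrite -zw z1 perm1.
have even_z : ~~ odd_perm z.
  by rewrite /z commgEl conjgE !odd_permM !odd_permV; case: odd_perm; case: odd_perm.
have cS : #|[set w; x w; y w]| = 3.
  rewrite setUC cardsU1 cards2 !inE negb_or yw (eq_sym w) xw.
  by case: eqP ywC => //= ->; rewrite perm_closed // wC.
apply: subset_trans (subsetIl _ 'Alt_T).
(* Inside [G :&: 'Alt_T] all elements are even, and homogeneity conjugates the 3-cycle [z] onto any
   triple. *)
apply: (@Alt_sub_of_triples _ (G :&: 'Alt_T)%G); first exact: subsetIr.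
move=> S' cS'; have [||h hG <-] := homog [set w; x w; y w] S'.
- by rewrite cS.
- by rewrite cS cS'.
apply: (@jordan_set_even3 _ _ _ (z ^ h)).
- by rewrite card_imset_perm.
- by rewrite inE Alt_even odd_permJ even_z andbT groupJ // groupR.
- exact: perm_on_imset.
- by rewrite odd_permJ.
by rewrite conjg_eq1.
Qed.

(** * Cycle types and invariant sets *)

Section CycleType.
Variable T : finType.
Implicit Types (g h : {perm T}) (Y : {set T}) (l : seq nat).

(** Fixed points count as cycles of length 1. The order of the list is free, so that any two cycles
    can be put first. *)
Definition cycle_type g l :=
  exists2 Ss : seq {set T}, perm_eq Ss (enum (porbits g)) & [seq #|X| | X : {set T} <- Ss] = l.

Lemma porbitJ g h x : porbit (g ^ h) (h x) = h @: porbit g x.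
Proof.
apply/setP=> y; apply/porbitP/imsetP => [[i ->]|[_ /porbitP[i ->] ->]].
  by exists ((g ^+ i) x); rewrite ?mem_porbit // -conjXg permJ.
by exists i; rewrite -conjXg permJ.
Qed.

Lemma porbitsJ g h : porbits (g ^ h) = [set h @: X | X : {set T} in porbits g].
Proof.
apply/setP=> X; apply/imsetP/imsetP => [[x _ ->]|[_ /imsetP[x _ ->] ->]].
  by exists (porbit g (h^-1 x)); rewrite ?imset_f // -porbitJ permKV.
by exists (h x); rewrite ?porbitJ.
Qed.

Lemma cycle_typeJ g h l : cycle_type g l -> cycle_type (g ^ h) l.
Proof.
case=> Ss pSs <-; exists [seq h @: X | X : {set T} <- Ss]; last first.
  by rewrite -map_comp; apply: eq_map => X /=; rewrite card_imset_perm.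
have inj_h : injective (fun X : {set T} => h @: X).
  by move=> X Y E; rewrite -(imset_permK h X) E imset_permK.
apply: uniq_perm; rewrite ?enum_uniq ?(map_inj_uniq inj_h) ?(perm_uniq pSs) ?enum_uniq //.
move=> X; rewrite mem_enum porbitsJ; apply/mapP/imsetP => [][Y].
  by rewrite (perm_mem pSs) mem_enum; exists Y.
by move=> Yg ->; exists Y; rewrite ?(perm_mem pSs) ?mem_enum.
Qed.

Lemma odd_cycle_type g l : cycle_type g l -> odd_perm g = odd #|T| (+) odd (size l).
Proof. by case=> Ss pSs <-; rewrite size_map (perm_size pSs) -cardE. Qed.

Lemma exists_partition l (D : {set T}) : all (leq 1) l -> #|D| = sumn l ->
  exists Ss : seq {set T}, [/\ uniq Ss, partition [set X in Ss] D &
    [seq #|X| | X : {set T} <- Ss] = l].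
Proof.
elim: l D => [|a l IH] D /=.
  move=> _ /eqP; rewrite cards_eq0 => /eqP->; exists [::]; split=> //.
  by rewrite partition_set0; apply/eqP/setP=> X; rewrite !inE.
case/andP=> a0 al cD; have [|A sAD cA] := @subset_of_card _ D a; first by rewrite cD leq_addr.
have [|Ss [uSs pSs mSs]] := IH (D :\: A) al.
  by rewrite cardsD (setIidPr sAD) cD cA addKn.
have A0 : A != set0 by rewrite -card_gt0 cA.
exists (A :: Ss); split=> /=; last by rewrite cA mSs.
  rewrite uSs andbT; apply: contraNN A0 => ASs.
  have := partitionS pSs; move/(_ A); rewrite inE ASs => /(_ isT).
  by rewrite subsetD -setI_eq0 setIid => /andP[].
have -> : D = A :|: (D :\: A) by rewrite -[LHS](setID D A) (setIidPr sAD).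
have -> : [set X in A :: Ss] = A |: [set X in Ss] by apply/setP=> X; rewrite !inE.
by apply: partitionU1 => //; rewrite -setI_eq0 setIDA setIC setDIl setDv setI0.
Qed.

(** In a partition with block sizes [l], each point is sent to the next one in the enumeration of
    its block. *)
Lemma exists_cycle_type l : all (leq 1) l -> sumn l = #|T| -> exists g, cycle_type g l.
Proof.
move=> l0 sl; have [|Ss [uSs pSs mSs]] := @exists_partition l setT l0; first by rewrite cardsT.
pose P := [set X in Ss]; have [/eqP cP tP P0] := and3P pSs.
pose p x := enum (pblock P x).
have px x : x \in p x by rewrite mem_enum mem_pblock cP inE.
pose f x := next (p x) x.
have fp x : f x \in p x by rewrite mem_next px.
have eqp x y : y \in p x -> p y = p x.
  rewrite /p mem_enum => yx; rewrite (def_pblock tP _ yx) //.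
  by apply: pblock_mem; rewrite cP inE.
have inj_f : injective f.
  move=> x y E; have pxy : p x = p y by rewrite -(eqp _ _ (fp x)) E (eqp _ _ (fp y)).
  by move: E; rewrite /f pxy => /(can_inj (prev_next (enum_uniq _))).
pose g := perm inj_f.
have gE x i : (g ^+ i) x = iter i (next (p x)) x.
  elim: i => [|i IH]; first by rewrite expg0 perm1.
  rewrite expgSr permM IH iterS permE /f; congr next; apply: eqp.
  by elim: i {IH} => [|i IH]; rewrite ?px // iterS mem_next.
have pE x : porbit g x = pblock P x.
  apply/setP=> y; rewrite -[RHS]mem_enum -/(p x); apply/porbitP/idP => [[i ->]|yx].
    by rewrite gE; elim: i => [|i IH]; rewrite ?px // iterS mem_next.
  have := fconnect_cycle (cycle_next (enum_uniq (pblock P x))) (px x) y.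
  by rewrite yx => /iter_findex <-; eexists; rewrite gE.
exists g; exists Ss => //; apply: uniq_perm; rewrite ?enum_uniq // => X.
rewrite mem_enum; apply/idP/imsetP => [XS|[x _ ->]].
  have /set0Pn[x xX] := partition_neq0 pSs (B := X) ltac:(by rewrite inE).
  by exists x; rewrite // pE (def_pblock tP _ xX) // inE.
by rewrite pE; have := pblock_mem (P := P) (x := x); rewrite cP !inE; apply.
Qed.

Lemma sub_porbit_stable g Y x : {in Y, forall y, g y \in Y} -> x \in Y -> porbit g x \subset Y.
Proof.
move=> gY xY; apply/subsetP=> _ /porbitP[i ->].
by elim: i => [|i IH]; rewrite ?expg0 ?perm1 // expgSr permM gY.
Qed.

(** An invariant set is the union of the cycles it contains; the mask records which ones. *)
Lemma card_stable g Y (Ss : seq {set T}) : {in Y, forall y, g y \in Y} ->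
  perm_eq Ss (enum (porbits g)) ->
  #|Y| = sumn (mask [seq X \subset Y | X : {set T} <- Ss] [seq #|X| | X : {set T} <- Ss]).
Proof.
move=> gY pSs; have -> : #|Y| = \sum_(X in porbits g | X \subset Y) #|X|.
  rewrite -sum1_card (partition_big (porbit g) (fun X => (X \in porbits g) && (X \subset Y))).
    apply: eq_bigr => X /andP[/imsetP[x _ ->] sub]; rewrite -sum1_card.
    apply: eq_bigl => y; rewrite eq_porbit_mem; apply/andP/idP => [[]//|yx].
    by rewrite (subsetP sub).
  by move=> y yY; rewrite imset_f // sub_porbit_stable.
rewrite -big_enum_cond /= -(perm_big _ pSs) /=.
elim: Ss {pSs} => [|X Ss IH]; first by rewrite big_nil.
by rewrite big_cons IH /=; case: ifP.
Qed.

(** Chinese remainders: an exponent that is 0 modulo [N] and [i] modulo [#|A|] gives a power of [g]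
    acting as [g ^+ i] on [A] and trivially elsewhere. *)
Lemma jordan_set_porbit (G : {group {perm T}}) g (A : {set T}) N :
  g \in G -> A \in porbits g -> coprime N #|A| ->
  {in porbits g, forall X : {set T}, X != A -> #|X| %| N} -> jordan_set G A.
Proof.
move=> gG /imsetP[x0 _ AE] coN dvN.
have expgE x e : (g ^+ e) x = (g ^+ (e %% #|porbit g x|)) x.
  rewrite {1}(divn_eq e #|porbit g x|) addnC expgD permM !permX.
  set y := iter _ _ x; have -> : porbit g x = porbit g y by rewrite /y -permX porbit_perm.
  rewrite iterM; elim: (e %/ _) => // k IH.
  by rewrite iterS IH iter_porbit.
apply/jordan_setP => x y; rewrite AE -eq_porbit_mem => /eqP Ex.
rewrite -Ex => /porbitP[i ->]; pose e := chinese N #|A| 0 i.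
have cA : #|porbit g x| = #|A| by rewrite AE Ex.
exists (g ^+ e); split; first exact: groupX.
- rewrite Ex; apply/subsetP=> z; rewrite inE -AE; apply: contraR => zA; apply/eqP.
  rewrite expgE; suff /eqP-> : #|porbit g z| %| e by rewrite expg0 perm1.
  have : e = 0 %[mod N] by apply: chinese_modl.
  rewrite mod0n => /eqP; apply: dvdn_trans; apply: dvN; first exact: imset_f.
  by apply: contraNneq zA => <-; apply: porbit_id.
by rewrite expgE [RHS]expgE cA /e chinese_modr.
Qed.

End CycleType.

(** * Groups containing permutations of given cycle types *)

Section Generation.
Variable T : finType.
Implicit Types (G : {group {perm T}}) (g h : {perm T}) (X Y A D : {set T}) (l r : seq nat).

(** The translates of [X] that meet [D] partition it. *)
Lemma dvdn_card_block G X D : transitive_perm G -> stable_block G X -> X != set0 ->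
  {in G, forall g, g @: X :&: D != set0 -> g @: X \subset D} -> #|X| %| #|D|.
Proof.
move=> trG bX X0 subD; pose P := [set Y in [set (g : {perm T}) @: X | g in G] | Y \subset D].
have blk g h : g \in G -> h \in G -> g @: X :&: h @: X != set0 -> g @: X = h @: X.
  move=> gG hG meet; have := stable_block_imset hG bX (groupM (groupVr hG) gG).
  by rewrite imsetM imset_permK; apply.
suff pP : partition P D.
  rewrite (card_uniform_partition (n := #|X|) _ pP) ?dvdn_mull // => Y.
  by rewrite inE => /andP[/imsetP[g _ ->] _]; rewrite card_imset_perm.
apply/and3P; split.
- rewrite eqEsubset; apply/andP; split.
    by apply/bigcupsP=> Y; rewrite inE => /andP[].
  apply/subsetP=> d dD; have /set0Pn[x xX] := X0.
  have [g gG gx] := trG x d (in_setT _) (in_setT _).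
  have dgX : d \in g @: X by rewrite -gx imset_f.
  apply/bigcupP; exists (g @: X) => //; rewrite inE imset_f //=.
  by apply: subD => //; apply/set0Pn; exists d; rewrite inE dgX.
- apply/trivIsetP=> _ _ /setIdP[/imsetP[g gG ->] _] /setIdP[/imsetP[h hG ->] _].
  by rewrite -setI_eq0; apply: contraNT => /(blk _ _ gG hG)->.
apply/negP; rewrite inE => /andP[/imsetP[g _ E] _].
by move: X0; rewrite -card_gt0 -(card_imset_perm g) -E cards0.
Qed.

(** A translate of [X] meeting [A] lies in [A] or contains it. In the second case [g] preserves the
    translate, which is thus a union of cycles whose size divides [#|T|]; by hypothesis it can only
    be [A]. *)
Lemma dvdn_card_block_porbit G g A (Rs : seq {set T}) X : g \in G -> transitive_perm G ->
  perm_eq (A :: Rs) (enum (porbits g)) -> jordan_set G A ->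
  (forall m, size m = size Rs -> has id m ->
     let c := #|A| + sumn (mask m [seq #|R| | R : {set T} <- Rs]) in c %| #|T| -> c = #|T|) ->
  stable_block G X -> X != set0 -> X != setT -> #|X| %| #|A|.
Proof.
move=> gG trG pR JA noY bX X0 XT; apply: (@dvdn_card_block G) => // h hG meet.
have cardX : #|X| %| #|T|.
  by rewrite -[#|T|]cardsT; apply: (@dvdn_card_block G).
have [sub|//] := orP (block_jordan_set (stable_block_imset hG bX) JA meet).
pose Y := h @: X; have gA : {in A, forall x, g x \in A}.
  have : A \in porbits g by rewrite -mem_enum -(perm_mem pR) mem_head.
  case/imsetP=> x0 _ -> x; rewrite -!eq_porbit_mem => /eqP <-.
  by rewrite -[g x]/((g ^+ 1) x) porbit_perm.
have [x /setIP[_ xA]] := set0Pn _ meet.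
have gY : {in Y, forall x, g x \in Y}.
  have E : g @: Y = Y.
    apply: (stable_block_imset hG bX gG); apply/set0Pn; exists (g x).
    by rewrite inE mem_imset_perm !(subsetP sub) ?gA.
  by move=> y yY; rewrite -E mem_imset_perm.
have := card_stable gY pR; rewrite /= [A \subset Y]sub /= => cY.
have [no|some] := boolP (has id [seq R \subset Y | R : {set T} <- Rs]); last first.
  suff -> : h @: X = A by [].
  apply/esym/eqP; rewrite eqEcard sub -/Y cY -[X in _ <= X]addn0 leq_add2l leqn0.
  apply/eqP; elim: {+}Rs some => //= R Rs' IH; rewrite negb_or => /andP[/negPf-> /IH].
  by [].
have := noY _ (size_map _ _) no; rewrite /= -cY /Y card_imset_perm => /(_ cardX) E.
by case/negP: XT; rewrite eqEcard subsetT cardsT E leqnn.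
Qed.

(* The cycles of lengths [a] and [b] are Jordan sets by coprimality; the
   divisibility conditions exclude the blocks that strictly contain one of them,
   such a block being a union of cycles. *)
Definition jordan_type n l :=
  if l is a :: b :: r then
    [/\ 2 < a, 3 * a <= n & 1 < b] /\
    [/\ coprime a b, coprime (\prod_(c <- r) c) a & coprime (\prod_(c <- r) c) b] /\
    (forall m, size m = size (b :: r) -> has id m ->
       let c := a + sumn (mask m (b :: r)) in c %| n -> c = n) /\
    (forall m, size m = size (a :: r) -> has id m ->
       let c := b + sumn (mask m (a :: r)) in c %| n -> c = n)
  else False.

(** The size of a proper nonempty block divides the coprime lengths of both special cycles, so it is
    1 and the group is primitive. *)
Lemma Alt_sub_of_jordan_type G g l : transitive_perm G -> g \in G ->
  cycle_type g l -> jordan_type #|T| l -> 'Alt_T \subset G.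
Proof.
move=> trG gG [[|A [|B Rs]] pS <-] //= [[a2 a3 b1] [[cab ca cb] [noA noB]]].
have memS X : X \in porbits g -> X \in [:: A, B & Rs].
  by rewrite -mem_enum (perm_mem pS).
have AB : A != B.
  by have := perm_uniq pS; rewrite enum_uniq /= inE negb_or => /andP[/andP[]].
have Ag : A \in porbits g by rewrite -mem_enum -(perm_mem pS) mem_head.
have Bg : B \in porbits g by rewrite -mem_enum -(perm_mem pS) !inE eqxx orbT.
have dvR X : X \in Rs -> #|X| %| \prod_(c <- [seq #|R| | R : {set T} <- Rs]) c.
  move=> XR; rewrite big_map (big_rem X) //= dvdn_mulr //.
have JA : jordan_set G A.
  apply: (jordan_set_porbit (N := #|B| * \prod_(c <- [seq #|R| | R : {set T} <- Rs]) c) gG Ag).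
    by rewrite coprimeMl ca andbT coprime_sym.
  move=> X /memS; rewrite !inE => /or3P[/eqP->|/eqP->|/dvR]; rewrite ?eqxx //.
    by rewrite dvdn_mulr.
  by move=> dv _; rewrite dvdn_mull.
have JB : jordan_set G B.
  apply: (jordan_set_porbit (N := #|A| * \prod_(c <- [seq #|R| | R : {set T} <- Rs]) c) gG Bg).
    by rewrite coprimeMl cb andbT.
  move=> X /memS; rewrite !inE => /or3P[/eqP->|/eqP->|/dvR]; rewrite ?eqxx //.
    by rewrite dvdn_mulr.
  by move=> dv _; rewrite dvdn_mull.
apply: (Alt_sub_of_jordan_set _ JA a2 a3); split=> // X bX X1.
apply/eqP/negPn/negP=> XT; have X0 : X != set0 by rewrite -card_gt0 ltnW.
have dA : #|X| %| #|A|.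
  apply: (dvdn_card_block_porbit gG trG pS JA) => // m.
  rewrite /= -(size_map (fun R : {set T} => #|R|)).
  exact: noA.
have dB : #|X| %| #|B|.
  have pS' : perm_eq (B :: A :: Rs) (enum (porbits g)).
    by rewrite -(permPr pS) -cat1s -(cat1s A) perm_catCA.
  apply: (dvdn_card_block_porbit gG trG pS' JB) => // m.
  rewrite /= -(size_map (fun R : {set T} => #|R|)); exact: noB.
have : #|X| %| gcdn #|A| #|B| by rewrite dvdn_gcd dA.
by rewrite (eqP cab) dvdn1 => /eqP E; rewrite E in X1.
Qed.

(* Subset sums of the cycle lengths are the sizes of the invariant sets. *)
Definition spread n l l' := forall m m', size m = size l -> size m' = size l' ->
  sumn (mask m l) = sumn (mask m' l') -> sumn (mask m l) = 0 \/ sumn (mask m l) = n.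

(** An orbit is invariant under both [g] and [h], so its size is a subset sum of both lists. *)
Lemma spread_transitive G g h l l' : g \in G -> h \in G ->
  cycle_type g l -> cycle_type h l' -> spread #|T| l l' -> transitive_perm G.
Proof.
move=> gG hG [Ss pS <-] [Ss' pS' <-] spr x y _ _.
pose Y := [set (k : {perm T}) x | k in G].
have stab k : k \in G -> {in Y, forall z, k z \in Y}.
  move=> kG _ /imsetP[k' k'G ->]; apply/imsetP; exists (k' * k); rewrite ?groupM //.
  by rewrite permM.
have cg := card_stable (stab g gG) pS; have ch := card_stable (stab h hG) pS'.
have Y0 : 0 < #|Y| by apply/card_gt0P; exists x; apply/imsetP; exists 1; rewrite ?group1 ?perm1.
have [] := spr _ _ _ _ (etrans (esym cg) ch); rewrite ?size_map // -cg => E.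
  by rewrite E in Y0.
have YT : Y = setT by apply/eqP; rewrite eqEcard subsetT cardsT E leqnn.
have : y \in Y by rewrite YT inE.
by case/imsetP=> k kG ->; exists k.
Qed.

(** Otherwise the length of the first cycle, neither 0 nor [#|T|], would be a common subset sum.
    This makes the classes of distinct indices distinct. *)
Lemma spread_disjoint g l l' : jordan_type #|T| l ->
  cycle_type g l -> cycle_type g l' -> ~ spread #|T| l l'.
Proof.
move=> jl gl [Ss' pS' <-] spr; case: gl jl spr => [[|A [|B Rs]] pS <-] //= [[a2 a3 _] _] spr.
have /imsetP[x _ Ax] : A \in porbits g by rewrite -mem_enum -(perm_mem pS) mem_head.
have gA : {in A, forall x, g x \in A}.
  rewrite Ax => y; rewrite -!eq_porbit_mem => /eqP <-.
  by rewrite -[g y]/((g ^+ 1) y) porbit_perm.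
have cA := card_stable gA pS; have cA' := card_stable gA pS'.
have : #|A| = 0 \/ #|A| = #|T|.
  by rewrite {1 2}cA; apply: spr (etrans (esym cA) cA'); rewrite /= ?size_map.
by move: a2 a3; set n := #|T|; clearbody n; clear; lia.
Qed.

Lemma Alt_sub_generated g h l l' : cycle_type g l -> cycle_type h l' ->
  jordan_type #|T| l -> spread #|T| l l' -> 'Alt_T \subset <<[set g; h]>>.
Proof.
move=> gl hl' jl spr.
have gG : g \in <<[set g; h]>> by rewrite mem_gen ?set21.
have hG : h \in <<[set g; h]>> by rewrite mem_gen ?set22.
exact: Alt_sub_of_jordan_type (spread_transitive gG hG gl hl' spr) gG gl jl.
Qed.

End Generation.

(** * Lower bounds for [kappa] from families of cycle types *)

(** One class is taken for each index. The last hypothesis bridges the gap between containing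
    ['Alt_T] and being all of [G]. *)
Lemma leq_kappa (T : finType) (G : {group {perm T}}) (I : seq nat) (ty : nat -> seq nat) :
  uniq I ->
  {in I, forall t, exists2 g, g \in G & cycle_type g (ty t)} ->
  {in I, forall t, jordan_type #|T| (ty t)} ->
  {in I &, forall t t', t != t' -> spread #|T| (ty t) (ty t')} ->
  {in I, forall t g (K : {group {perm T}}), K \subset G -> g \in K ->
    cycle_type g (ty t) -> 'Alt_T \subset K -> G \subset K} ->
  size I <= kappa G.
Proof.
move=> uI exI jI sI genI.
have [|rep repP] := @boolp.choice nat {perm T}
    (fun t g => t \in I -> g \in G /\ cycle_type g (ty t)).
  move=> t; have [tI|tI] := boolP (t \in I); last by exists 1.
  by have [g gG gt] := exI t tI; exists g.
pose C t := rep t ^: G.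
have CP t g : t \in I -> g \in C t -> g \in G /\ cycle_type g (ty t).
  move=> /repP[rG rt] /imsetP[k kG ->]; split; first by rewrite groupJ.
  exact: cycle_typeJ.
have injC : {in I &, injective C}.
  move=> t t' tI t'I E; apply/eqP; apply: contraT => tt'.
  have [rG rt] := repP t tI; have : rep t \in C t' by rewrite -E class_refl.
  by case/(CP _ _ t'I) => _ rt'; case: (spread_disjoint (jI t tI) rt rt'); apply: sI.
pose X := [set x in [seq C t | t <- I]].
have <- : #|X| = size I.
  rewrite cardsE (card_uniqP _) ?size_map // map_inj_in_uniq //.
rewrite /kappa; apply: (@leq_bigmax_cond _ _ (fun X : {set {set {perm T}}} => #|X|)).
apply/andP; split.
  apply/subsetP=> D; rewrite inE => /mapP[t tI ->].
  by apply: mem_classes; case: (repP t tI).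
apply/forall_inP=> D; rewrite inE => /mapP[t tI ->].
apply/forall_inP=> D'; rewrite inE => /mapP[t' t'I ->]; apply/implyP=> CC.
have tt' : t != t' by apply: contraNneq CC => ->.
apply/forall_inP=> g /(CP _ _ tI)[gG gt]; apply/forall_inP=> h /(CP _ _ t'I)[hG ht].
have sub : <<[set g; h]>> \subset G by rewrite gen_subG subUset !sub1set gG.
rewrite eqEsubset sub /=.
apply: (genI t tI g <<[set g; h]>>%G) => //; first by rewrite mem_gen ?set21.
exact: Alt_sub_generated gt ht (jI t tI) (sI t t' tI t'I tt').
Qed.

Definition valid_type n l := all (leq 1) l && (sumn l == n).

(** The parity condition makes the chosen permutations odd, and an odd permutation generates the
    symmetric group together with the alternating group. *)
Lemma leq_kappa_Sym n (I : seq nat) (ty : nat -> seq nat) : uniq I ->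
  {in I, forall t, valid_type n (ty t) && (odd n (+) odd (size (ty t)))} ->
  {in I, forall t, jordan_type n (ty t)} ->
  {in I &, forall t t', t != t' -> spread n (ty t) (ty t')} ->
  size I <= kappa 'Sym_('I_n).
Proof.
move=> uI vI jI sI; apply: (leq_kappa (ty := ty)); rewrite ?card_ord // => t tI.
  have /andP[/andP[l0 /eqP sl] _] := vI t tI.
  have [|g gt] := @exists_cycle_type 'I_n _ l0; first by rewrite card_ord.
  by exists g; rewrite ?inE.
move=> g K _ gK gt AK; apply/subsetP=> s _.
have odd_g : odd_perm g by rewrite (odd_cycle_type gt) card_ord; case/andP: (vI t tI).
have [so|se] := boolP (odd_perm s); last by rewrite (subsetP AK) // Alt_even.
by rewrite -(groupMr _ gK) (subsetP AK) // Alt_even odd_permM so odd_g.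
Qed.

Lemma leq_kappa_Alt n (I : seq nat) (ty : nat -> seq nat) : uniq I ->
  {in I, forall t, valid_type n (ty t) && ~~ (odd n (+) odd (size (ty t)))} ->
  {in I, forall t, jordan_type n (ty t)} ->
  {in I &, forall t t', t != t' -> spread n (ty t) (ty t')} ->
  size I <= kappa 'Alt_('I_n).
Proof.
move=> uI vI jI sI; apply: (leq_kappa (ty := ty)); rewrite ?card_ord // => t tI //.
have /andP[/andP[l0 /eqP sl] even_t] := vI t tI.
have [|g gt] := @exists_cycle_type 'I_n _ l0; first by rewrite card_ord.
by exists g; rewrite // Alt_even (odd_cycle_type gt) card_ord.
Qed.

End PermutationGroups.

(** * Families of cycle types *)

Section CycleTypeFamilies.
Local Open Scope nat_scope.

Lemma ndvdn_between q c n : q * c < n -> n < q.+1 * c -> ~~ (c %| n).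
Proof.
move=> lt1 lt2; apply/negP=> /dvdnP[k nE]; subst n.
have c0 : 0 < c by case: c lt1 lt2 => //; rewrite !muln0.
by rewrite !ltn_pmul2r // in lt1 lt2; lia.
Qed.

Definition type3 n a b := [:: a; b; n - (a + b)].
(* A third cycle of length [a + b] is automatically prime to [a] and [b]. *)
Definition type4 n a b := [:: a; b; a + b; n - 2 * (a + b)].

(** With [k = 1] for [type3] and [k = 2] for [type4]: modulo [a] the last length [n - k * (a + b)]
    is [n - k * b], and modulo [b] it is [n - k * a]. In this form each condition involves only
    linear expressions in one of [a] and [b], as suits the sieve. *)
Definition coprime_pair k n a b :=
  [&& coprime a b, coprime a (n - k * b) & coprime b (n - k * a)].

Lemma coprime_rest k n a b : k * (a + b) <= n -> coprime_pair k n a b ->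
  coprime (n - k * (a + b)) a && coprime (n - k * (a + b)) b.
Proof.
move=> le /and3P[_ ca cb]; apply/andP; split; rewrite coprime_sym.
  have E : n - k * b = k * a + (n - k * (a + b)) by nia.
  by move: ca; rewrite E /coprime gcdnMDl.
have E : n - k * a = k * b + (n - k * (a + b)) by nia.
by move: cb; rewrite E /coprime gcdnMDl.
Qed.

(** The proper unions to exclude have size [a + b], which is handled by hypothesis, and [n - a] or
    [n - b], which lie strictly between [n / 2] and [n]. *)
Lemma jordan_type3 n a b : 2 < a -> 3 * a <= n -> 1 < b -> 2 * b < n ->
  a + b < n -> ~~ (a + b %| n) -> coprime_pair 1 n a b -> jordan_type n (type3 n a b).
Proof.
move=> a2 a3 b1 b2 abn nab cp; have cab := cp; case/and3P: cab => cab _ _.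
have := coprime_rest _ cp; rewrite !mul1n => /(_ (ltnW abn))/andP[ca cb].
split=> //; split; first by rewrite !big_seq1.
split=> -[|m0 [|m1 [|]]] //= _; case: m0; case: m1 => //= _ H.
- by lia.
- by rewrite addn0 (negPf nab) in H.
- by case/negP: (@ndvdn_between 1 (a + (n - (a + b) + 0)) n ltac:(lia) ltac:(lia)).
- by lia.
- by rewrite addn0 addnC (negPf nab) in H.
- by case/negP: (@ndvdn_between 1 (b + (n - (a + b) + 0)) n ltac:(lia) ltac:(lia)).
Qed.

(* In these windows, [a + b] lies strictly between [n / 5] and [n / 4], [2a + b]
   between [n / 4] and [n / 3], and [a + 2b] and [2a + 2b] between [n / 3] and
   [n / 2]. *)
Lemma jordan_type4 n a b : 2 < a -> 1 < b ->
  n < 20 * a -> 40 * a < 3 * n -> 3 * n < 20 * b -> 40 * b < 7 * n ->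
  coprime_pair 2 n a b -> jordan_type n (type4 n a b).
Proof.
move=> a2 b1 a20 a40 b20 b40 cp; have cab := cp; case/and3P: cab => cab _ _.
have /andP[ca cb] : coprime (n - 2 * (a + b)) a && coprime (n - 2 * (a + b)) b.
  by apply: coprime_rest cp; lia.
split; first by split=> //; lia.
split.
  rewrite !big_cons big_nil muln1 !coprimeMl ca cb !andbT.
  by split=> //; rewrite /coprime gcdnC ?gcdnDl ?gcdnDr // gcdnC.
clear cp cab ca cb.
split=> -[|m0 [|m1 [|m2 [|]]]] //= _; case: m0; case: m1; case: m2 => //= _ H;
  first [by lia | exfalso; move: H; apply/negP;
    first [by apply: (@ndvdn_between 1); lia | by apply: (@ndvdn_between 2); lia
          |by apply: (@ndvdn_between 3); lia | by apply: (@ndvdn_between 4); lia]].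
Qed.

(** Up to complement the sums are [a], [b] and [a + b], all below [n / 2] and increasing in the
    index. The ranges of [a] and [b] are disjoint, and [a + b] differs from both by parity. *)
Lemma spread_type3_low n u w L t t' : 2 * u.+1 + 2 * L <= 2 * w.+1 ->
  2 * (2 * u.+1 + 2 * w.+1 + 4 * L) <= n -> t < L -> t' < L -> t != t' ->
  spread n (type3 n (2 * (u + t)).+1 (2 * (w + t)).+1)
           (type3 n (2 * (u + t')).+1 (2 * (w + t')).+1).
Proof.
move=> h1 h2 tL t'L /eqP tt' [|m0 [|m1 [|m2 [|]]]] // [|k0 [|k1 [|k2 [|]]]] // _ _.
by case: m0; case: m1; case: m2; case: k0; case: k1; case: k2 => /= E; lia.
Qed.

(** Up to complement the sums are the three lengths, all below [n / 2]; the third is even, the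
    others are odd with disjoint ranges. *)
Lemma spread_type3_mid n u w L t t' : 2 * u.+1 + 2 * L <= 2 * w.+1 -> ~~ odd n ->
  4 * (w + L) < n -> n < 4 * (u + w).+1 -> t < L -> t' < L -> t != t' ->
  spread n (type3 n (2 * (u + t)).+1 (2 * (w + t)).+1)
           (type3 n (2 * (u + t')).+1 (2 * (w + t')).+1).
Proof.
move=> h1 h0 h2 h3 tL t'L /eqP tt' [|m0 [|m1 [|m2 [|]]]] // [|k0 [|k1 [|k2 [|]]]] // _ _.
have nE : n = 2 * n./2 by rewrite mul2n even_halfK.
move: (n./2) nE h2 h3 => k -> h2 h3.
by case: m0; case: m1; case: m2; case: k0; case: k1; case: k2 => /= E; lia.
Qed.

(** Up to complement the sums are [a], [b], [a + b], [2a + b], [a + 2b] and [2a + 2b], all below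
    [n / 2] and increasing in the index. Their ranges are disjoint except for the last two, which
    differ in parity. *)
Lemma spread_type4 n u w L t t' : n < 40 * u -> 80 * (u + L) < 3 * n - 80 ->
  3 * n < 40 * w -> 80 * (w + L) < 7 * n - 80 -> t < L -> t' < L -> t != t' ->
  spread n (type4 n (2 * (u + t)).+1 (2 * (w + t)).+1)
           (type4 n (2 * (u + t')).+1 (2 * (w + t')).+1).
Proof.
move=> h1 h2 h3 h4 tL t'L /eqP tt'.
move=> [|m0 [|m1 [|m2 [|m3 [|]]]]] // [|k0 [|k1 [|k2 [|k3 [|]]]]] // _ _.
by case: m0; case: m1; case: m2; case: m3; case: k0; case: k1; case: k2; case: k3 => /= E; lia.
Qed.

End CycleTypeFamilies.

(** * Products over the primes *)

Section PrimeProducts.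
Variables (R : realType) (f : nat -> R).
Hypothesis f01 : forall p, prime p -> 0 <= f p <= 1.
Local Notation u := (fun N : nat => \prod_(0 <= p < N | prime p) f p : R).

Lemma prod_primes_recr (N : nat) : u N.+1 = u N * (if prime N then f N else 1).
Proof. by rewrite /= [LHS]big_mkcond big_nat_recr //= -big_mkcond. Qed.

Lemma partial_prod_ge0 (N : nat) : 0 <= u N.
Proof. by apply: prodr_ge0 => p /f01/andP[]. Qed.

Lemma partial_prod_nincr : nonincreasing_seq u.
Proof.
apply/nonincreasing_seqP => N; rewrite prod_primes_recr ler_piMr ?partial_prod_ge0 //.
by case: ifP => // /f01/andP[].
Qed.

Lemma cvg_partial_prod : cvgn u.
Proof.
apply: nonincreasing_is_cvgn; first exact: partial_prod_nincr.
by exists 0 => _ [N _ <-]; apply: partial_prod_ge0.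
Qed.

Lemma prod_primes_le (N : nat) : prod_primes f <= u N.
Proof. exact: nonincreasing_cvgn_ge partial_prod_nincr cvg_partial_prod N. Qed.

Lemma prod_primes_ge c (M : nat) : (forall N : nat, (M <= N)%N -> c <= u N) -> c <= prod_primes f.
Proof.
move=> H; apply: limr_ge; first exact: cvg_partial_prod.
by exists M => // N /= leMN; apply: H.
Qed.

(** Weierstrass's inequality: a product of factors [1 - x] in the unit interval is at least 1 minus
    the sum of the [x]. *)
Lemma partial_prod_tail (g : nat -> R) (M N : nat) : (M <= N)%N ->
  (forall p, prime p -> 1 - f p <= g p) ->
  u M * (1 - \sum_(M <= p < N | prime p) g p) <= u N.
Proof.
move=> leMN fg; have g0 p : prime p -> 0 <= g p.
  by move=> pp; apply: le_trans (fg p pp); rewrite subr_ge0; case/andP: (f01 pp).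
elim: N leMN => [|N IH].
  by rewrite leqn0 => /eqP->; rewrite [X in 1 - X]big_geq // subr0 mulr1.
rewrite leq_eqVlt => /predU1P[->|ltMN]; first by rewrite [X in 1 - X]big_geq // subr0 mulr1.
have {}IH := IH ltMN; rewrite prod_primes_recr.
rewrite [X in 1 - X]big_mkcond big_nat_recr //= -big_mkcond /=.
case: ifP => [pN|_]; last by rewrite addr0 mulr1.
have uM := partial_prod_ge0 M; have uN := partial_prod_ge0 N.
have fgN := fg N pN; have gN := g0 N pN.
have uMN : u N <= u M by apply: partial_prod_nincr.
have h1 : u N * (1 - g N) <= u N * f N by rewrite ler_wpM2l //; move: fgN; lra.
have h2 : u N * g N <= u M * g N by rewrite ler_wpM2r.
by move: IH h1 h2; rewrite !mulrBr !mulrDr !mulr1; lra.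
Qed.

End PrimeProducts.

Section Tail.
Variable R : realType.

(** A prime in this interval exceeds [W], hence is coprime to it, which leaves [totient W]
    residues. *)
Lemma sum_prime_block (W k : nat) : (0 < W)%N -> (1 < k)%N ->
  \sum_(W * k <= p < W * k.+1 | prime p) (p%:R ^+ 2)^-1
    <= (totient W)%:R / (W%:R * k%:R) ^+ 2 :> R.
Proof.
move=> W0 k1; have k0 := ltnW k1; rewrite -[X in \sum_(X <= _ < _ | _) _]add0n big_addn.
have -> : (W * k.+1 - W * k = W)%N by rewrite mulnS addnK.
have x0 : 0 < (W%:R * k%:R) ^+ 2 :> R by rewrite exprn_gt0 // mulr_gt0 ?ltr0n.
rewrite totient_count_coprime natr_sum mulr_suml big_mkcond.
apply: ler_sum_nat => r /andP[_ rW]; case: ifP => [pr|_]; last first.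
  by rewrite mulr_ge0 ?ler0n // invr_ge0 ltW.
have -> : coprime W r.
  have := pr; case/primeP=> _ /(_ (gcdn W r)); rewrite /coprime dvdn_addr ?dvdn_gcdr //.
  rewrite dvdn_mulr ?dvdn_gcdl // => /(_ isT)/orP[//|/eqP E].
  have : (gcdn W r <= W)%N by apply: dvdn_leq (dvdn_gcdl _ _).
  rewrite {}E leqNgt; suff -> : (W < r + W * k)%N by [].
  by rewrite (leq_trans _ (leq_addl _ _)) // -[X in (X < _)%N]muln1 ltn_pmul2l.
rewrite mul1r lef_pV2 ?posrE //; last first.
  by rewrite exprn_gt0 // ltr0n addn_gt0 muln_gt0 W0 k0 orbT.
by rewrite lerXn2r ?nnegrE ?mulr_ge0 ?ler0n // -natrM ler_nat leq_addl.
Qed.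

(** The block bounds telescope by [1 / k^2 <= 1 / (k - 1) - 1 / k]. *)
Lemma sum_prime_tail (W K N : nat) : (0 < W)%N -> (1 < K)%N ->
  \sum_(W * K <= p < N | prime p) (p%:R ^+ 2)^-1
    <= (totient W)%:R / W%:R ^+ 2 / K.-1%:R :> R.
Proof.
move=> W0 K1; pose F J := \sum_(W * K <= p < W * (K + J) | prime p) (p%:R ^+ 2)^-1 : R.
have c0 : 0 <= (totient W)%:R / W%:R ^+ 2 :> R by rewrite divr_ge0 ?exprn_ge0 ?ler0n.
have FJ J : F J <= (totient W)%:R / W%:R ^+ 2 * (K.-1%:R^-1 - (K + J).-1%:R^-1).
  elim: J => [|J IH]; first by rewrite /F addn0 big_geq // subrr mulr0.
  rewrite /F (big_cat_nat _ (n := W * (K + J))) //=; first last.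
  - by rewrite leq_pmul2l // leq_add2l.
  - by rewrite leq_pmul2l // leq_addr.
  have kJ : (1 < K + J)%N by rewrite (leq_trans K1) // leq_addr.
  rewrite addnS; apply: le_trans (lerD IH (sum_prime_block W0 kJ)) _.
  have E (x : R) : (totient W)%:R / (W%:R * x) ^+ 2 = (totient W)%:R / W%:R ^+ 2 * (x ^+ 2)^-1.
    by rewrite exprMn invfM mulrA.
  rewrite E -[X in X <= _]mulrDr ler_wpM2l //.
  case: (K + J)%N kJ => [|[|k]] // _ /=.
  have k0 : 0 < k.+1%:R :> R by rewrite ltr0n.
  have -> : k.+2%:R = k.+1%:R + 1 :> R by rewrite -natr1.
  set x := k.+1%:R in k0 *; set y := (K.-1)%:R^-1.
  have : ((x + 1) ^+ 2)^-1 <= x^-1 - (x + 1)^-1.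
    have -> : x^-1 - (x + 1)^-1 = (x * (x + 1))^-1.
      by field; rewrite !gt_eqF //; lra.
    have x1 : 0 < x + 1 by lra.
    by rewrite lef_pV2 ?posrE ?exprn_gt0 ?mulr_gt0 // expr2 ler_pM2r //; lra.
  by move: (x^-1) (x + 1)^-1 ((x + 1) ^- 2) => a b c; lra.
have leN : (N <= W * (K + N))%N.
  by rewrite (leq_trans (leq_addl K N)) // leq_pmull.
have [leWK|ltWK] := leqP N (W * K).
  by rewrite big_geq // divr_ge0 ?ler0n.
have : \sum_(W * K <= p < N | prime p) (p%:R ^+ 2)^-1 <= F N :> R.
  rewrite /F (big_cat_nat _ (n := N) (p := W * (K + N))) ?(ltnW ltWK) //= lerDl.
  by apply: sumr_ge0 => p _; rewrite invr_ge0 exprn_ge0 ?ler0n.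
move=> /le_trans; apply; apply: le_trans (FJ N) _; rewrite ler_wpM2l //.
by rewrite lerBlDr lerDl invr_ge0 ler0n.
Qed.
End Tail.

(** * Certified fixed-point evaluation of partial products *)

Module FixedPoint.
(* Only [sieved_prime] matters: a composite number that passes the test would
   only make the computed lower bound smaller. *)
Definition small_primes : seq N :=
  [:: 2; 3; 5; 7; 11; 13; 17; 19; 23; 29; 31; 37; 41; 43; 47; 53; 59; 61; 67; 71;
  73; 79; 83; 89; 97; 101; 103; 107; 109; 113; 127; 131; 137; 139; 149; 151; 157;
  163; 167; 173]%num.

(** The test is exact below [179^2 = 32041], which covers the ranges evaluated later. *)
Definition sieved (p : N) : bool :=
  N.ltb 1 p && all (fun d => ~~ (N.eqb (N.modulo p d) 0) || N.eqb p d) small_primes.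

(** [acc] stays below the scaled product over the primes less than [p]; the extra 1 compensates for
    the rounding down of the quotient. *)
Definition step (A B : N -> N) (s : N * N) : N * N :=
  let: (p, acc) := s in
  ((p + 1)%num, if sieved p then (acc - (A p * acc / B p + 1))%num else acc).

Definition lower_prod A B scale M := N.iter M (step A B) (0%num, scale).

Lemma sieved_prime p : prime (N.to_nat p) -> sieved p.
Proof.
move=> pp; apply/andP; split; first by apply/N.ltb_spec0; move: (prime_gt1 pp); lia.
apply/allP=> d ds; rewrite -implybE; apply/implyP=> /N.eqb_spec pd.
have d1 : (1 < N.to_nat d)%N by move: d ds {pd}; apply/allP.
have dp : (N.to_nat d %| N.to_nat p)%N.
  apply/dvdnP; exists (N.to_nat (N.div p d)).
  have {1}-> : p = (d * (p / d))%num :> N by rewrite {1}(N.div_mod' p d) pd N.add_0_r.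
  by rewrite N2Nat.inj_mul mulnC.
apply/N.eqb_spec/N2Nat.inj/eqP.
case/primeP: pp => _ /(_ _ dp)/orP[/eqP E|]; first by rewrite E in d1.
by rewrite eq_sym.
Qed.

Section Bound.
Variables (R : realType) (f : nat -> R) (A B : N -> N).
Hypothesis f01 : forall p, prime p -> 0 <= f p <= 1.
Hypothesis fE : forall p, prime (N.to_nat p) -> (0 < N.to_nat (B p))%N /\
  f (N.to_nat p) = 1 - (N.to_nat (A p))%:R / (N.to_nat (B p))%:R :> R.

Lemma lower_prodP scale M : let: (p, acc) := lower_prod A B scale M in p = M /\
  (N.to_nat acc)%:R <= (N.to_nat scale)%:R *
     \prod_(0 <= q < N.to_nat p | prime q) f q :> R.
Proof.
rewrite /lower_prod; elim/N.peano_ind: M => [|M].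
  by rewrite /=; split=> //; rewrite big_geq ?mulr1.
rewrite N.iter_succ; case: (N.iter _ _ _) => p acc [-> IH] /=.
split; first by rewrite N.add_1_r.
have -> : N.to_nat (M + 1) = (N.to_nat M).+1 by lia.
have u0 := partial_prod_ge0 f01 (N.to_nat M).
rewrite prod_primes_recr mulrA; set u := \prod_(_ <= _ < _ | _) _ in IH u0 *.
have [pM|npM] := boolP (prime (N.to_nat M)); last first.
  rewrite mulr1; case: ifP => // _; apply: le_trans IH.
  by rewrite ler_nat N2Nat.inj_sub leq_subr.
rewrite sieved_prime //; have [B0 fM] := fE pM; have /andP[fM0 _] := f01 pM.
apply: le_trans (_ : (N.to_nat acc)%:R * f (N.to_nat M) <= _); last first.
  by rewrite ler_wpM2r.
set q := (A M * acc / B M)%num.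
have qP : (N.to_nat (A M) * N.to_nat acc <= N.to_nat (B M) * (N.to_nat q).+1)%N.
  have B0' : B M <> 0%num by move: B0; lia.
  have := N.mul_succ_div_gt (A M * acc) _ B0'; rewrite -/q.
  move=> h; have : (N.to_nat (A M * acc) < N.to_nat (B M * N.succ q))%N by lia.
  by rewrite !N2Nat.inj_mul N2Nat.inj_succ; lia.
(* If the subtraction truncates to 0, the bound is just nonnegativity. *)
have [le|gt] := leqP (N.to_nat acc) (N.to_nat q + 1).
  have -> : N.to_nat (acc - (q + 1)) = 0%N by lia.
  by rewrite mulr_ge0.
have -> : N.to_nat (acc - (q + 1)) = (N.to_nat acc - (N.to_nat q).+1)%N by lia.
rewrite natrB; last by lia.
rewrite fM mulrBr mulr1 lerD2l lerN2 mulrA ler_pdivrMr ?ltr0n //.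
by rewrite -!natrM ler_nat mulnC [X in (_ <= X)%N]mulnC.
Qed.

End Bound.
End FixedPoint.

Section AlphaBeta.
Variable R : realType.
Local Notation fa := (fun p : nat => 1 - 2 / p%:R ^+ 2 : R).
Local Notation fb := (fun p : nat => 1 - (3 * p%:R - 2) / p%:R ^+ 3 : R).

Lemma prime_ge2R p : prime p -> 2 <= p%:R :> R.
Proof. by move/prime_gt1; rewrite -(ler_nat R). Qed.

Lemma alpha_factor01 p : prime p -> 0 <= fa p <= 1.
Proof.
move=> /prime_ge2R p2; have p0 : 0 < p%:R ^+ 2 :> R by rewrite exprn_gt0 //; lra.
rewrite subr_ge0 ler_pdivrMr // mul1r gerBl divr_ge0 ?(ltW p0) //.
by rewrite andbT; nra.
Qed.

Lemma beta_factor01 p : prime p -> 0 <= fb p <= 1.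
Proof.
move=> /prime_ge2R p2; have p0 : 0 < p%:R ^+ 3 :> R by rewrite exprn_gt0 //; lra.
rewrite subr_ge0 ler_pdivrMr // mul1r gerBl divr_ge0 ?(ltW p0) //; last lra.
rewrite andbT -subr_ge0.
have -> : p%:R ^+ 3 - (3 * p%:R - 2) = (p%:R - 1) ^+ 2 * (p%:R + 2) :> R by ring.
by rewrite mulr_ge0 ?sqr_ge0 //; lra.
Qed.

(** Partial products bound the limit from above; the inequalities for [kappa] rest on such upper
    bounds. *)
Lemma alpha_le : alpha R <= 338 / 1000.
Proof.
apply: le_trans (prod_primes_le alpha_factor01 12) _.
rewrite -big_filter; have -> : [seq p <- index_iota 0 12 | prime p] = [:: 2; 3; 5; 7; 11]%N by [].
by rewrite !big_cons big_nil; lra.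
Qed.

Lemma beta_le : beta R <= 38 / 100.
Proof.
apply: le_trans (prod_primes_le beta_factor01 4) _.
rewrite -big_filter; have -> : [seq p <- index_iota 0 4 | prime p] = [:: 2; 3]%N by [].
by rewrite !big_cons big_nil; lra.
Qed.

(** The run certifies that the product over the primes below [30 * K] is at least [h / d], with [s]
    setting the precision. The tail is bounded with [W = 30], where [totient 30 = 8]. *)
Lemma prod_primes_fixed_ge (f : nat -> R) (A B : N -> N) (h d s K : N) k :
  (forall p, prime p -> 0 <= f p <= 1) ->
  (forall p, prime (N.to_nat p) -> (0 < N.to_nat (B p))%N /\
    f (N.to_nat p) = 1 - (N.to_nat (A p))%:R / (N.to_nat (B p))%:R :> R) ->
  (forall p, prime p -> 1 - f p <= k * (p%:R ^+ 2)^-1) ->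
  (1 < N.to_nat K)%N -> (0 < N.to_nat s)%N -> (0 < N.to_nat d)%N -> 0 <= k ->
  k * (8 / 900 / (N.to_nat K).-1%:R) <= 1 ->
  N.leb (h * s)%num (FixedPoint.lower_prod A B (d * s) (30 * K)).2%num ->
  (N.to_nat h)%:R / (N.to_nat d)%:R * (1 - k * (8 / 900 / (N.to_nat K).-1%:R))
    <= prod_primes f.
Proof.
move=> f01 fE fk K1 s0 d0 k0 le1 /N.leb_spec0 run.
have := FixedPoint.lower_prodP f01 fE (d * s)%num (30 * K)%num.
move: run; case: (FixedPoint.lower_prod _ _ _ _) => _ acc /= run [-> accP].
have ME : N.to_nat (30 * K)%num = (30 * N.to_nat K)%N by rewrite N2Nat.inj_mul.
apply: (prod_primes_ge f01 (M := N.to_nat (30 * K)%num)) => N leN.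
apply: le_trans (partial_prod_tail f01 leN fk).
apply: ler_pM.
- by rewrite divr_ge0 ?ler0n.
- by rewrite subr_ge0.
- have sR : 0 < (N.to_nat s)%:R :> R by rewrite ltr0n.
  rewrite ler_pdivrMr ?ltr0n // mulrC -(ler_pM2r sR) mulrAC -!natrM.
  rewrite N2Nat.inj_mul in accP; apply: le_trans accP.
  have : (N.to_nat (h * s)%num <= N.to_nat acc)%N by lia.
  by rewrite N2Nat.inj_mul ler_nat.
rewrite lerD2l lerN2 -mulr_sumr ler_wpM2l // ME.
apply: le_trans (sum_prime_tail R N (W := 30) isT K1) _.
have -> : totient 30 = 8 by [].
rewrite ler_wpM2r ?invr_ge0 ?ler0n //; lra.
Qed.

Lemma alpha_gt : 3 / 10 + 2 / 10 ^+ 2 + 2 / 10 ^+ 3 + 6 / 10 ^+ 4 + 3 / 10 ^+ 5 < alpha R.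
Proof.
have fE p : prime (N.to_nat p) -> (0 < N.to_nat (p * p)%num)%N /\
    fa (N.to_nat p) = 1 - (N.to_nat 2%num)%:R / (N.to_nat (p * p)%num)%:R :> R.
  move=> /prime_gt0 p0; rewrite N2Nat.inj_mul; split; first by rewrite muln_gt0 p0.
  by rewrite natrM expr2.
have fk p : prime p -> 1 - fa p <= 2 * (p%:R ^+ 2)^-1 by move=> _ /=; lra.
(* 754 / 2337 is slightly below the product over the primes less than 31500. *)
have run : N.leb (754 * 10 ^ 15)
    (FixedPoint.lower_prod (fun=> 2) (fun p => p * p) (2337 * 10 ^ 15) (30 * 1050)).2%num.
  by vm_compute.
have KE : (N.to_nat 1050).-1%:R = 1049 :> R by [].
have s0 : (0 < N.to_nat (10 ^ 15))%N.
  by have : (10 ^ 15)%num <> 0%num by []; move: (10 ^ 15)%num => x; lia.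
(* With the tail factor the bound is about 0.3226304. *)
have := prod_primes_fixed_ge alpha_factor01 fE fk (isT : (1 < N.to_nat 1050)%N)
  s0 (isT : (0 < N.to_nat 2337)%N) _ _ run.
rewrite KE => H; apply: lt_le_trans (H _ _); [|by clear; lra|by clear; lra].
clear.
have -> : (N.to_nat 754)%:R = 754 :> R by [].
have -> : (N.to_nat 2337)%:R = 2337 :> R by [].
lra.
Qed.

Lemma beta_gt : 2 / 10 + 8 / 10 ^+ 2 + 6 / 10 ^+ 3 + 6 / 10 ^+ 4 + 5 / 10 ^+ 5 < beta R.
Proof.
have fE p : prime (N.to_nat p) -> (0 < N.to_nat (p * p * p)%num)%N /\
    fb (N.to_nat p) = 1 - (N.to_nat (3 * p - 2)%num)%:R / (N.to_nat (p * p * p)%num)%:R :> R.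
  move=> pp; have p0 := prime_gt0 pp; rewrite !N2Nat.inj_mul; split.
    by rewrite !muln_gt0 p0.
  have -> : N.to_nat (3 * p - 2)%num = (3 * N.to_nat p - 2)%N by lia.
  rewrite natrB; last by have := prime_gt1 pp; lia.
  by rewrite !natrM -expr2 -exprSr.
have fk p : prime p -> 1 - fb p <= 3 * (p%:R ^+ 2)^-1.
  move=> /prime_ge2R p2; have p0 : 0 < p%:R :> R by lra.
  have -> : 3 * (p%:R ^+ 2)^-1 = 3 * p%:R / p%:R ^+ 3 :> R.
    by field; rewrite gt_eqF.
  rewrite /= opprB addrC subrK ler_pM2r ?invr_gt0 ?exprn_gt0 //; lra.
(* 39 / 136 is slightly below the product over the primes less than 3000. *)
have run : N.leb (39 * 10 ^ 15)
    (FixedPoint.lower_prod (fun p => 3 * p - 2) (fun p => p * p * p)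
      (136 * 10 ^ 15) (30 * 100)).2%num.
  by vm_compute.
have KE : (N.to_nat 100).-1%:R = 99 :> R by [].
have s0 : (0 < N.to_nat (10 ^ 15))%N.
  by have : (10 ^ 15)%num <> 0%num by []; move: (10 ^ 15)%num => x; lia.
have := prod_primes_fixed_ge beta_factor01 fE fk (isT : (1 < N.to_nat 100)%N)
  s0 (isT : (0 < N.to_nat 136)%N) _ _ run.
rewrite KE => H; apply: lt_le_trans (H _ _); [|by clear; lra|by clear; lra].
clear.
have -> : (N.to_nat 39)%:R = 39 :> R by [].
have -> : (N.to_nat 136)%:R = 136 :> R by [].
lra.
Qed.

End AlphaBeta.

(** * Counting coprime pairs *)

Section Sieve.
Local Open Scope nat_scope.

(** The solutions lie in one residue class modulo [p], so their quotients by [p] are distinct. *)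
Lemma sum_residue_class p X (P : pred nat) : 0 < p ->
  (forall x y, x < y < X -> P x -> P y -> p %| y - x) ->
  \sum_(0 <= x < X) (P x : nat) <= X %/ p + 1.
Proof.
move=> p0 dvP; have -> : \sum_(0 <= x < X) (P x : nat) = size [seq x %/ p | x <- iota 0 X & P x].
  rewrite size_map size_filter -sum1_count [RHS]big_mkcond /index_iota subn0.
  by apply: eq_bigr => x _; case: (P x).
rewrite addn1 -(size_iota 0 (X %/ p).+1); apply: uniq_leq_size; last first.
  move=> _ /mapP[x + ->]; rewrite mem_filter !mem_iota /= !add0n => /andP[_ xX].
  by rewrite ltnS leq_div2r // ltnW.
have dvE x y : x < y < X -> P x -> P y -> x %/ p <> y %/ p.
  move=> xy Px Py E; have := dvP _ _ xy Px Py => /dvdnP[c cE].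
  have c0 : 0 < c by case: c cE => // cE; lia.
  have := divn_eq x p; have := divn_eq y p; rewrite E.
  by have := ltn_pmod x p0; have := ltn_pmod y p0; nia.
rewrite map_inj_in_uniq ?filter_uniq ?iota_uniq // => x y.
rewrite !mem_filter !mem_iota /= !add0n => /andP[Px xX] /andP[Py yX] E.
case: (ltngtP x y) => // h; first by case: (dvE x y _ Px Py E); rewrite h.
by case: (dvE y x _ Py Px (esym E)); rewrite h.
Qed.

Lemma sum_residue_class2 p X Y (P : pred nat) (Q : nat -> pred nat) : 0 < p ->
  (forall x y, x < y < X -> P x -> P y -> p %| y - x) ->
  (forall t x y, t < X -> x < y < Y -> Q t x -> Q t y -> p %| y - x) ->
  \sum_(0 <= t < X) \sum_(0 <= s < Y) (P t && Q t s : nat) <= (X %/ p + 1) * (Y %/ p + 1).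
Proof.
move=> p0 dvP dvQ; apply: leq_trans (_ : \sum_(0 <= t < X) P t * (Y %/ p + 1) <= _).
  rewrite big_nat [leqRHS]big_nat; apply: leq_sum => t /andP[_ tX].
  case: (P t) => /=; last by rewrite big1.
  by rewrite mul1n; apply: sum_residue_class => // x y; apply: dvQ.
by rewrite -big_distrl leq_mul2r sum_residue_class ?orbT.
Qed.

Section Counting.
Variables (k n u v : nat).
Hypothesis k12 : (k == 1) || (k == 2).
Local Notation a t := (2 * (u + t)).+1.
Local Notation b t s := (2 * (v + s + t)).+1.
Variables X Y : nat.
Hypothesis aX : forall t, t < X -> k * a t <= n.
Hypothesis bXY : forall t s, t < X -> s < Y -> k * b t s <= n.

Definition obstruction p t s :=
  [|| (p %| a t) && (p %| b t s), (p %| a t) && (p %| n - k * b t s) |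
      (p %| n - k * a t) && (p %| b t s)].

(** An obstructing prime divides [a] or [b]; these are odd and at most [n], whence the bounds on
    [p]. *)
Lemma exists_obstruction t s : t < X -> s < Y -> ~~ coprime_pair k n (a t) (b t s) ->
  exists p, [/\ 2 < p < n.+1, prime p & obstruction p t s].
Proof.
move=> tX sY; have lea := aX tX; have leb := bXY tX sY.
have k0 : 0 < k by case/orP: k12 => /eqP->.
have odd_dvd p c : prime p -> p %| (2 * c).+1 -> k * (2 * c).+1 <= n -> 2 < p < n.+1.
  move=> pp dv le; apply/andP; split; last first.
    by have := dvdn_leq (ltn0Sn _) dv; nia.
  rewrite ltn_neqAle prime_gt1 // andbT; apply: contraTneq dv => <-.
  by rewrite dvdn2 /= mul2n odd_double.
have key c d : 0 < c -> ~~ coprime c d -> exists p, [/\ prime p, p %| c & p %| d].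
  move=> c0 ncd; exists (pdiv (gcdn c d)).
  have g1 : 1 < gcdn c d by rewrite ltn_neqAle eq_sym ncd gcdn_gt0 c0.
  by have := pdiv_dvd (gcdn c d); rewrite pdiv_prime // dvdn_gcd => /andP[].
rewrite !negb_and => /or3P[] /key[] // p [pp pa pb]; exists p; rewrite /obstruction pa pb ?orbT.
- by rewrite (odd_dvd _ _ pp pa lea).
- by rewrite (odd_dvd _ _ pp pa lea).
- by rewrite (odd_dvd _ _ pp pa leb).
Qed.

(** Each of the three conditions fixes [t] modulo [p] and then, for given [t], fixes [s] modulo [p],
    because 2 and [k] are invertible modulo the odd prime [p]. *)
Lemma sum_obstruction p : prime p -> 2 < p ->
  \sum_(0 <= t < X) \sum_(0 <= s < Y) (obstruction p t s : nat)
    <= 3 * ((X %/ p + 1) * (Y %/ p + 1)).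
Proof.
move=> pp p2; have p0 : 0 < p by apply: prime_gt0.
have co2 c : 0 < c < 3 -> coprime p c.
  move=> /andP[c0 c3]; rewrite prime_coprime //; apply/negP=> /(dvdn_leq c0) le.
  by move: (leq_ltn_trans le c3); rewrite ltnNge p2.
have da x y : x < y < X -> p %| a x -> p %| a y -> p %| y - x.
  move=> /andP[xy _] px py; have := dvdn_sub py px.
  by rewrite (_ : a y - a x = 2 * (y - x)) ?Gauss_dvdr ?co2 //; lia.
have db t x y : t < X -> x < y < Y -> p %| b t x -> p %| b t y -> p %| y - x.
  move=> _ /andP[xy _] px py; have := dvdn_sub py px.
  by rewrite (_ : b t y - b t x = 2 * (y - x)) ?Gauss_dvdr ?co2 //; lia.
have k0 : 0 < k < 3 by case/orP: k12 => /eqP->.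
have dna x y : x < y < X -> p %| n - k * a x -> p %| n - k * a y -> p %| y - x.
  move=> /andP[xy yX] px py; have le := aX yX; have := dvdn_sub px py.
  rewrite (_ : n - k * a x - (n - k * a y) = k * (2 * (y - x))); last by nia.
  by rewrite !Gauss_dvdr ?co2.
have dnb t x y : t < X -> x < y < Y -> p %| n - k * b t x -> p %| n - k * b t y -> p %| y - x.
  move=> tX /andP[xy yY] px py; have le := bXY tX yY; have := dvdn_sub px py.
  rewrite (_ : n - k * b t x - (n - k * b t y) = k * (2 * (y - x))); last by nia.
  by rewrite !Gauss_dvdr ?co2.
have h1 := sum_residue_class2 p0 da db.
have h2 := sum_residue_class2 p0 da dnb.
have h3 := sum_residue_class2 p0 dna db.
rewrite mulSn mulSn mul1n.
apply: leq_trans (leq_add h1 (leq_add h2 h3)).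
rewrite -!big_split /=; apply: leq_sum => t _; rewrite -!big_split /=; apply: leq_sum => s _.
rewrite /obstruction; by do 3 case: (_ && _).
Qed.

Lemma sum_not_coprime_pair :
  \sum_(0 <= s < Y) \sum_(0 <= t < X) (~~ coprime_pair k n (a t) (b t s) : nat)
    <= \sum_(3 <= p < n.+1 | prime p) 3 * ((X %/ p + 1) * (Y %/ p + 1)).
Proof.
rewrite exchange_big_nat /=.
apply: leq_trans (_ : \sum_(3 <= p < n.+1 | prime p) \sum_(0 <= t < X) \sum_(0 <= s < Y)
   (obstruction p t s : nat) <= _); last first.
  rewrite big_nat_cond [leqRHS]big_nat_cond; apply: leq_sum => p /andP[/andP[p2 _] pp].
  exact: sum_obstruction.
rewrite [leqRHS](exchange_big_dep_nat predT) //= big_nat [leqRHS]big_nat.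
apply: leq_sum => t /andP[_ tX].
rewrite [leqRHS](exchange_big_dep_nat predT) //= big_nat [leqRHS]big_nat.
apply: leq_sum => s /andP[_ sY].
have [//|/(exists_obstruction tX sY)[p [pn pp pb]]] := boolP (coprime_pair _ _ _ _).
by rewrite big_mkcond (bigD1_seq p) ?mem_index_iota ?iota_uniq //= pp pb.
Qed.

End Counting.

End Sieve.

Section Density.
Variable R : realType.

Lemma sum_inv_sq_prime (n : nat) : (1 < n)%N ->
  \sum_(3 <= p < n.+1 | prime p) (p%:R ^+ 2)^-1 <= 209 / 1000 :> R.
Proof.
(* Extending the range makes the cut at [30 = 6 * 5] possible for every [n]. *)
move=> n1; apply: le_trans (_ : \sum_(3 <= p < n + 30 | prime p) (p%:R ^+ 2)^-1 <= _).
  rewrite [leRHS](big_cat_nat _ (n := n.+1)) //=; last by rewrite -addn1 leq_add2l.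
  by rewrite lerDl; apply: sumr_ge0 => p _; rewrite invr_ge0 exprn_ge0.
rewrite (big_cat_nat _ (n := 6 * 5)) //=; last by rewrite leq_addl.
rewrite -big_filter.
have -> : [seq p <- index_iota 3 30 | prime p] = [:: 3; 5; 7; 11; 13; 17; 19; 23; 29]%N by [].
apply: le_trans (lerD (lexx _) (sum_prime_tail R _ (W := 6) (K := 5) isT isT)) _.
have -> : totient 6 = 2 by [].
by rewrite !big_cons big_nil /=; lra.
Qed.

Lemma sum_inv_prime (n K : nat) : (1 < n)%N -> (0 < K)%N ->
  \sum_(3 <= p < n.+1 | prime p) p%:R^-1 <= K%:R + n%:R / K%:R :> R.
Proof.
move=> n1 K0; have K0R : 0 < K%:R :> R by rewrite ltr0n.
(* [1 / p <= K / p ^ 2] if [p < K], and [1 / p <= 1 / K] otherwise *)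
apply: le_trans (_ : \sum_(3 <= p < n.+1 | prime p) (K%:R * (p%:R ^+ 2)^-1 + K%:R^-1) <= _).
  apply: ler_sum => p /prime_gt0 p0; have p0R : 0 < p%:R :> R by rewrite ltr0n.
  have [lepK|ltKp] := leP K%:R (p%:R : R).
    apply: le_trans (_ : K%:R^-1 <= _); first by rewrite lef_pV2.
    by rewrite lerDr mulr_ge0 // invr_ge0 exprn_ge0.
  apply: le_trans (_ : K%:R * (p%:R ^+ 2)^-1 <= _); last by rewrite lerDl invr_ge0.
  rewrite ler_pdivlMr ?exprn_gt0 // expr2 mulrA mulVf ?gt_eqF // mul1r; exact: ltW.
rewrite big_split /= -mulr_sumr; apply: lerD.
  rewrite -[leRHS]mulr1 ler_wpM2l //; apply: le_trans (sum_inv_sq_prime n1) _; lra.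
rewrite big_mkcond; apply: le_trans (_ : \sum_(3 <= p < n.+1) K%:R^-1 <= _).
  by apply: ler_sum => p _; case: ifP => // _; rewrite invr_ge0.
rewrite sumr_const_nat -[_ *+ (_ - _)]mulr_natl ler_wpM2r ?invr_ge0 // ler_nat; lia.
Qed.

Lemma sum_box_prime (n X Y K : nat) : (1 < n)%N -> (0 < K)%N ->
  (\sum_(3 <= p < n.+1 | prime p) 3 * ((X %/ p + 1) * (Y %/ p + 1)))%N%:R
    <= 3 * (209 / 1000 * (X%:R * Y%:R) + (X%:R + Y%:R) * (K%:R + n%:R / K%:R) + n%:R) :> R.
Proof.
move=> n1 K0; rewrite natr_sum.
apply: le_trans (_ : \sum_(3 <= p < n.+1 | prime p)
   3 * (X%:R * Y%:R * (p%:R ^+ 2)^-1 + (X%:R + Y%:R) * p%:R^-1 + 1) <= _).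
  apply: ler_sum => p /prime_gt0 p0; have p0R : 0 < p%:R :> R by rewrite ltr0n.
  have divR Z : (Z %/ p)%N%:R <= Z%:R * p%:R^-1 :> R.
    by rewrite ler_pdivlMr // -natrM ler_nat leq_trunc_div.
  rewrite !natrM ler_wpM2l // !natrD.
  apply: le_trans (_ : (X%:R * p%:R^-1 + 1) * (Y%:R * p%:R^-1 + 1) <= _).
    by apply: ler_pM; rewrite ?addr_ge0 ?lerD2r.
  rewrite -exprVn; move: p%:R^-1 => x; lra.
rewrite -mulr_sumr ler_wpM2l // !big_split /= -!mulr_sumr.
apply: lerD; first apply: lerD.
- rewrite mulrC ler_wpM2r ?mulr_ge0 //; exact: sum_inv_sq_prime.
- by rewrite ler_wpM2l ?addr_ge0 // sum_inv_prime.
rewrite big_mkcond; apply: le_trans (_ : \sum_(3 <= p < n.+1) 1 <= _).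
  by apply: ler_sum => p _; case: ifP.
rewrite sumr_const_nat ler_nat; lia.
Qed.

(* [115 / 10 < 32 * (1 - 3 * 209 / 1000)] *)
Lemma many_coprime_pairs : exists N0, forall N k n u v : nat, (N0 <= N)%N ->
  (k == 1%N) || (k == 2%N) -> (1 < n <= 2801 * N)%N ->
  (forall t, t < 32 * N -> k * (2 * (u + t)).+1 <= n)%N ->
  (forall t s, t < 32 * N -> s < N -> k * (2 * (v + s + t)).+1 <= n)%N ->
  exists2 s, (s < N)%N & (115 * N <=
    10 * \sum_(0 <= t < 32 * N) coprime_pair k n (2 * (u + t)).+1 (2 * (v + s + t)).+1)%N.
Proof.
(* With this [K] and the threshold on [N], the terms from [n / K] and the remaining lower-order
   terms each contribute at most [N^2 / 10]. *)
have [K K0 KP] : exists2 K : nat, (0 < K)%N & 2801 * 99 * 10 <= K%:R :> R.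
  have /archi_boundP h : 0 <= 2801 * 99 * 10 :> R by lra.
  set K := Num.bound _ in h; exists K; last exact: ltW.
  by rewrite lt0n; apply: contraTneq h => ->; rewrite -leNgt; lra.
exists ((99 * K + 3 * 2801) * 10 + 1)%N => N k n u v leN k12 /andP[n1 nN] aX bX.
pose cnt s := (\sum_(0 <= t < 32 * N) coprime_pair k n (2 * (u + t)).+1 (2 * (v + s + t)).+1)%N.
have [/hasP[s]|/hasPn few] := boolP (has (fun s => 115 * N <= 10 * cnt s)%N (iota 0 N)).
  by rewrite mem_iota add0n => /andP[_ sN] le; exists s.
exfalso; have := sum_not_coprime_pair k12 aX bX; set bad := (X in (X <= _)%N).
have total : (\sum_(0 <= s < N) cnt s + bad = 32 * N * N)%N.
  rewrite /bad /cnt -big_split /=.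
  under eq_bigr => s _.
    rewrite -big_split /= (eq_bigr (fun=> 1%N)); last by move=> t _; case: coprime_pair.
    rewrite sum_nat_const_nat subn0 muln1; over.
  by rewrite sum_nat_const_nat subn0 mulnC.
have few' : (10 * \sum_(0 <= s < N) cnt s <= 115 * N * N)%N.
  rewrite big_distrr /=; apply: leq_trans (_ : \sum_(0 <= s < N) 115 * N <= _)%N.
    rewrite big_nat [leqRHS]big_nat; apply: leq_sum => s sN.
    by apply: ltnW; rewrite ltnNge few // mem_iota.
  by rewrite sum_nat_const_nat subn0 mulnC.
(* Few good values for every [s] leave at least [(32 - 11.5) * N^2] bad pairs, while the sieve
   allows fewer than [20.3 * N^2]. *)
have many : (205 * N * N <= 10 * bad)%N by lia.
move=> le; have := sum_box_prime (32 * N) N n1 K0; rewrite leNgt => /negP; apply.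
move: le many; rewrite -2!(ler_nat R); set S := (X in _ <= X%:R) => le many.
have KR : 0 < K%:R :> R by rewrite ltr0n.
have NR : (99 * K%:R + 3 * 2801) * 10 + 1 <= N%:R :> R.
  have : (((99 * K + 3 * 2801) * 10 + 1)%N%:R <= N%:R :> R) by rewrite ler_nat.
  by rewrite natrD natrM natrD !natrM.
have nR : n%:R <= 2801 * N%:R :> R by rewrite -natrM ler_nat.
have N0 : 0 < N%:R :> R by lra.
have nK : n%:R / K%:R <= N%:R / 990 :> R.
  rewrite ler_pdivrMr //; nra.
apply: lt_le_trans le; move: many; rewrite !natrM; nra.
Qed.
End Density.

(** * Explicit families and the resulting bounds *)

Section KappaBounds.
Local Open Scope nat_scope.

Definition coprime_indices k n u w L :=
  [seq t <- iota 0 L | coprime_pair k n (2 * (u + t)).+1 (2 * (w + t)).+1].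

Lemma size_coprime_indices k n u w L : size (coprime_indices k n u w L) =
  \sum_(0 <= t < L) coprime_pair k n (2 * (u + t)).+1 (2 * (w + t)).+1.
Proof.
rewrite size_filter -sum1_count big_mkcond /index_iota subn0.
by apply: eq_bigr => t _; case: coprime_pair.
Qed.

Lemma coprime_indicesP k n u w L t : t \in coprime_indices k n u w L ->
  t < L /\ coprime_pair k n (2 * (u + t)).+1 (2 * (w + t)).+1.
Proof. by rewrite mem_filter mem_iota add0n => /andP[]. Qed.

Lemma valid_type3 n a b : 0 < a -> 0 < b -> a + b < n -> valid_type n (type3 n a b).
Proof. by move=> a0 b0 abn; rewrite /valid_type /= a0 b0 subn_gt0 abn; apply/eqP; lia. Qed.

Lemma valid_type4 n a b : 0 < a -> 0 < b -> 2 * (a + b) < n -> valid_type n (type4 n a b).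
Proof.
move=> a0 b0 abn; rewrite /valid_type /= a0 b0 addn_gt0 a0 subn_gt0 abn.
by apply/eqP; lia.
Qed.

(* [N = n / 400], [a < 64N + 3 <= b] and [a + b < n / 2]; since [a + b] is even it
   does not divide [n], and it differs from all the [a] and [b]. *)
Lemma kappa_Alt_odd_ge (R : realType) : exists n0, forall n, n0 <= n -> odd n ->
  115 * (n %/ 400) <= 10 * kappa 'Alt_('I_n).
Proof.
have [N0 count] := many_coprime_pairs R; exists (400 * (N0 + 2)) => n len odd_n.
set N := n %/ 400; have [nN1 nN2] : 400 * N <= n /\ n < 400 * N + 400.
  by have := divn_eq n 400; have := ltn_pmod n (isT : 0 < 400); rewrite -/N; lia.
have [||||s sN] := count N 1 n 1 (1 + 32 * N) _ isT; [lia|lia|lia|lia|].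
have [w wE] : exists w, w = 1 + 32 * N + s by eexists.
rewrite -wE -size_coprime_indices => /leq_trans; apply; rewrite leq_mul2l /=.
apply: (leq_kappa_Alt (ty := fun t => type3 n (2 * (1 + t)).+1 (2 * (w + t)).+1)).
- by rewrite filter_uniq // iota_uniq.
- move=> t /coprime_indicesP[tL _]; rewrite valid_type3 ?odd_n //; lia.
- move=> t /coprime_indicesP[tL cp]; apply: jordan_type3 => //; lia.
move=> t t' /coprime_indicesP[tL _] /coprime_indicesP[t'L _] tt'.
by apply: (spread_type3_low (L := 32 * N)) => //; lia.
Qed.

(* Here all the cycle lengths are less than [n / 2], and the third one is even. *)
Lemma kappa_Sym_even_ge (R : realType) : exists n0, forall n, n0 <= n -> ~~ odd n ->
  115 * (n %/ 400) <= 10 * kappa 'Sym_('I_n).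
Proof.
have [N0 count] := many_coprime_pairs R; exists (400 * (N0 + 100)) => n len even_n.
set N := n %/ 400; have [nN1 nN2] : 400 * N <= n /\ n < 400 * N + 400.
  by have := divn_eq n 400; have := ltn_pmod n (isT : 0 < 400); rewrite -/N; lia.
(* These offsets give [a + b > 200N + 200 > n / 2] and [b < 198N + 100 <= n / 2]. *)
have [||||s sN] := count N 1 n (34 * N + 50) (66 * N + 50) _ isT; [lia|lia|lia|lia|].
have [w wE] : exists w, w = 66 * N + 50 + s by eexists.
rewrite -wE -size_coprime_indices => /leq_trans; apply; rewrite leq_mul2l /=.
apply: (leq_kappa_Sym (ty := fun t => type3 n (2 * (34 * N + 50 + t)).+1 (2 * (w + t)).+1)).
- by rewrite filter_uniq // iota_uniq.
- move=> t /coprime_indicesP[tL _]; rewrite valid_type3 ?(negPf even_n) //; lia.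
- move=> t /coprime_indicesP[tL cp]; apply: jordan_type3 => //; try lia.
  by apply: (@ndvdn_between 1); lia.
move=> t t' /coprime_indicesP[tL _] /coprime_indicesP[t'L _] tt'.
by apply: (spread_type3_mid (L := 32 * N)) => //; lia.
Qed.

(** A permutation with four cycles is odd exactly when [n] is odd. The divisor 2800 exceeds
    [80 * 33], so that the shifts by [s < N] and [t < 32N] stay within the windows required of [a]
    and [b]. *)
Lemma kappa_type4_ge (R : realType) : exists n0, forall n, n0 <= n ->
  115 * (n %/ 2800) <= 10 * kappa (if odd n then 'Sym_('I_n) else 'Alt_('I_n))%G.
Proof.
have [N0 count] := many_coprime_pairs R; exists (2800 * (N0 + 2800)) => n len.
set N := n %/ 2800; have [nN1 nN2] : 2800 * N <= n /\ n < 2800 * N + 2800.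
  by have := divn_eq n 2800; have := ltn_pmod n (isT : 0 < 2800); rewrite -/N; lia.
pose u := n %/ 40 + 1; pose v := (3 * n) %/ 40 + 1.
have [uP vP] : 40 * u <= n + 40 < 40 * u + 40 /\ 40 * v <= 3 * n + 40 < 40 * v + 40.
  by rewrite /u /v; lia.
have [||||s sN] := count N 2 n u v _ isT; [lia|lia|lia|lia|].
have [w wE] : exists w, w = v + s by eexists.
rewrite -wE -size_coprime_indices => /leq_trans; apply; rewrite leq_mul2l /=.
set I := coprime_indices _ _ _ _ _.
pose ty t := type4 n (2 * (u + t)).+1 (2 * (w + t)).+1.
have uI : uniq I by rewrite filter_uniq // iota_uniq.
have vI : {in I, forall t, valid_type n (ty t)}.
  by move=> t /coprime_indicesP[tL _]; apply: valid_type4; lia.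
have jI : {in I, forall t, jordan_type n (ty t)}.
  by move=> t /coprime_indicesP[tL cp]; apply: jordan_type4 => //; lia.
have sI : {in I &, forall t t', t != t' -> spread n (ty t) (ty t')}.
  move=> t t' /coprime_indicesP[tL _] /coprime_indicesP[t'L _] tt'.
  by apply: (spread_type4 (L := 32 * N)) => //; lia.
case: ifP => odd_n.
  by apply: (leq_kappa_Sym uI _ jI sI) => t tI; rewrite vI //= odd_n.
by apply: (leq_kappa_Alt uI _ jI sI) => t tI; rewrite vI //= odd_n.
Qed.

End KappaBounds.

Theorem theorem1p3 (R : realType) :
  (forall eps : R, 0 < eps ->
    exists n_eps : nat, forall n : nat, (n_eps <= n)%N ->
      (kappa 'Sym_('I_n)%G)%:R / n%:R >=
        (if odd n then beta R / 120 - eps else alpha R / 12 - eps) /\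
      (kappa 'Alt_('I_n)%G)%:R / n%:R >=
        (if odd n then alpha R / 18 - eps else beta R / 150 - eps)) /\
  alpha R > 3 / 10 + 2 / 10 ^+ 2 + 2 / 10 ^+ 3 + 6 / 10 ^+ 4 + 3 / 10 ^+ 5 /\
  beta R > 2 / 10 + 8 / 10 ^+ 2 + 6 / 10 ^+ 3 + 6 / 10 ^+ 4 + 5 / 10 ^+ 5.
Proof.
split; last by split; [exact: alpha_gt|exact: beta_gt].
move=> eps eps0.
have [nA kA] := kappa_Alt_odd_ge R; have [nS kS] := kappa_Sym_even_ge R.
have [n4 k4] := kappa_type4_ge R.
exists (nA + nS + n4 + 2800 * 100)%N => n len.
have [n0 [ltA [ltS lt4]]] : (0 < n /\ nA <= n /\ nS <= n /\ n4 <= n)%N.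
  by move: len; clear; lia.
have d400 : (n < 400 * (n %/ 400).+1)%N by rewrite mulnC ltn_ceil.
have d2800 : (n < 2800 * (n %/ 2800).+1)%N by rewrite mulnC ltn_ceil.
have [m400 m2800] : (100 <= n %/ 400)%N /\ (100 <= n %/ 2800)%N.
  by move: len; clear; rewrite !leq_divRL //; lia.
have aU := alpha_le R; have bU := beta_le R.
(* For [m >= 100], the quotient [11.5 * m / (k * (m + 1))] is at least [1150 / (101 * k)]. The
   values of [c] below come from dividing the upper bounds 0.338 and 0.38 by 12, 18 or 120. *)
have ratio (c : R) (m k G : nat) : (115 * m <= 10 * G)%N -> (n < k * m.+1)%N ->
    (100 <= m)%N -> 0 <= c -> c * k%:R * 101 <= 1150 -> c <= G%:R / n%:R.
  move=> le nk m100 c0 ck; rewrite ler_pdivlMr ?ltr0n //.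
  have leR : 115 * m%:R <= 10 * G%:R :> R by rewrite -!natrM ler_nat.
  have nkR : n%:R <= k%:R * (m%:R + 1) :> R by rewrite natr1 -natrM ler_nat ltnW.
  have mR : 100 <= m%:R :> R by rewrite ler_nat.
  have k0 : 0 <= k%:R :> R by [].
  have : c * n%:R <= c * k%:R * (m%:R + 1) by rewrite -mulrA ler_wpM2l.
  have : c * k%:R * 101 * (m%:R + 1) <= 1150 * (m%:R + 1) by rewrite ler_wpM2r // addr_ge0.
  by move: leR mR; clear; move: (c * k%:R) (c * n%:R) (m%:R) (G%:R) => x y z w; nra.
have := k4 n lt4; case: ifP => odd_n le4.
  have le3 := kA n ltA odd_n; split.
    by apply: le_trans (ratio (38 / 12000) _ _ _ le4 d2800 m2800 _ _);
      move: bU eps0; clear; lra.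
  by apply: le_trans (ratio (338 / 18000) _ _ _ le3 d400 m400 _ _);
    move: aU eps0; clear; lra.
have le3 := kS n ltS (negbT odd_n); split.
  by apply: le_trans (ratio (338 / 12000) _ _ _ le3 d400 m400 _ _);
    move: aU eps0; clear; lra.
by apply: le_trans (ratio (38 / 12000) _ _ _ le4 d2800 m2800 _ _);
  move: bU eps0; clear; lra.
Qed.
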